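(* Let $n\ge3$, $m\ge2$, and let $\tilde Q_{n,m}$ be the enriched triangular grid quiver, with cluster $(\boldsymbol{x},\boldsymbol{X})$ consisting of the mutable variables $\boldsymbol{x}$ and the frozen variables $\boldsymbol{X}$. For every $1\le j\le m-1$, with $M=M_j$, and every $k\in\mathbb{Z}/n\mathbb{Z}$, $$\tilde{\mathcal{R}}_{M,k}(\tilde Q_{n,m},\boldsymbol{x},\boldsymbol{X})=(\tilde Q_{n,m},\tilde R_M(\boldsymbol{x}),\tilde R_M(\boldsymbol{X})),$$ where $\tilde{\mathcal{R}}_{M,k}$ is a sequence of $2n-2$ mutations and $2n+1$ transpositions of vertices and $\tilde R_M$ is the cluster $R$-matrix.
   Context: All second indices are taken in $\mathbb{Z}/n\mathbb{Z}$. Quiver $Q_{n,m}$: vertices $(j,i)$ with $0\le j\le m$, $i\in\mathbb{Z}/n\mathbb{Z}$; arrows $(j,i)\to(j,i+1)$ for $0\le j\le m$; $(j,i)\to(j-1,i)$ for $1\le j\le m$; $(j,i)\to(j+1,i-1)$ for $0\le j\le m-1$. $M_j=\{(j,i):i\in\mathbb{Z}/n\mathbb{Z}\}$. Enriched quiver $\tilde Q_{n,m}$: for every arrow $a\to a'$ of $Q_{n,m}$ add a frozen vertex $v_{a,a'}$ and arrows $a'\to v_{a,a'}$ and $v_{a,a'}\to a$. The variable at a vertex $(j,i)$ is the mutable variable $x_{j,i}$, and the variable at $v_{a,a'}$ is the frozen variable $X_{a,a'}$. Arrows between frozen vertices are disregarded. $\tilde{\mathcal{F}}$ is the field of rational functions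 over $\mathbb{Q}$ in all $x_{j,i}$ and all $X_{a,a'}$. Mutation: put $b_{uv}=\#\{u\to v\}-\#\{v\to u\}$. The mutation $\mu_k$ at a mutable vertex $k$ fixes all variables except that the variable $z_k$ at $k$ is replaced by $z_k^{-1}\big(\prod_{u:b_{uk}>0}z_u^{b_{uk}}+\prod_{u:b_{uk}<0}z_u^{-b_{uk}}\big)$ ($z_u$ denoting the variable at $u$, mutable or frozen), and replaces $b_{uv}$ by $-b_{uv}$ if $u=k$ or $v=k$, and by $b_{uv}+\tfrac12(|b_{uk}|b_{kv}+b_{uk}|b_{kv}|)$ otherwise. Fix $1\le j\le m-1$, $M=M_j$, and abbreviate $i=(j,i)$, $i^-=(j-1,i)$, $i^+=(j+1,i)$, and $x_i=x_{j,i}$, $x_i^-=x_{j-1,i}$, $x_i^+=x_{j+1,i}$. Thus the arrows of $Q_{n,m}$ incident to $i$ are $i\to i+1$, $i\to i^-$, $i\to(i-1)^+$, $i-1\to i$, $(i+1)^-\to i$, $i^+\to i$. Operation: let $\mu_i$ be mutation at $i\in M$, and let $s_{u,v}$ exchange the labels of vertices $u,v$ (acting on quiver and variables). Then $$\tilde{\mathcal{R}}_{M,k}=\prod_{i\in\mathbb{Z}/n\mathbb{Z}}s_{v_{i^+,i},\,v_{i+1,(i+1)^-}}\circ\prod_{i\in\mathbb{Z}/n\mathbb{Z}}s_{v_{i,(i-1)^+},\,v_{i^-,i-1}}\circ s_{k-2,k-1}\circ(\mu_k\circ\mu_{k+1}\circ\cdots\circ\mu_{k-3})\circ(\mu_{k-1}\circ\mu_{k-2}\circ\cdots\circ\mu_{k+1}\circ\mu_k),$$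 rightmost applied first: mutate at $k,k+1,\dots,k+n-1$, then at $k+n-3,k+n-4,\dots,k$ ($n-2$ mutations), then apply the transpositions. Cluster $R$-matrix: $\tilde R_M:\tilde{\mathcal{F}}\to\tilde{\mathcal{F}}$ is the rational transformation (field homomorphism) with $$\tilde R_M(x_i)=\frac{1}{\prod_{h\ne i}x_h}\sum_{l=i}^{i+n-1}x_{l+1}^-\Big(\prod_{h\in(\mathbb{Z}/n\mathbb{Z})\setminus\{l,l+1\}}x_h\Big)x_l^+\,X_{l,l+1}\Big(\prod_{h=l+1}^{i+n-1}X_{h^+,h}X_{(h+1)^-,h}\Big)\Big(\prod_{h=i+1}^{l}X_{h,h^-}X_{h,(h-1)^+}\Big)$$ (here $i,l,h$ in the sum and last two products are integers, reduced mod $n$ when used as indices; empty products are $1$), $$\tilde R_M(X_{i^+,i})=X_{i+1,(i+1)^-},\quad\tilde R_M(X_{i+1,(i+1)^-})=X_{i^+,i},\quad\tilde R_M(X_{i,(i-1)^+})=X_{i^-,i-1},\quad\tilde R_M(X_{i^-,i-1})=X_{i,(i-1)^+},$$ and fixing all other variables (in particular $x_i^\pm$, $X_{i,i+1}$ and everything not mentioned). *)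

(* Defs.v *)
From HB Require Import structures.
From mathcomp Require Import all_boot all_order all_algebra fraction.
From mathcomp Require Import mpoly.

Set Implicit Arguments.
Unset Strict Implicit.
Unset Printing Implicit Defensive.

Import Order.TTheory GRing.Theory Num.Theory.
Local Open Scope ring_scope.

Section Quiver.

Variables n m : nat.

(* The vertices (j, i) of Q_{n,m}.  'Z_n is Z/nZ only for n > 1. *)
Definition mut : predArgType := ('I_m.+1 * 'Z_n)%type.

(* The arrows of Q_{n,m}.  For n >= 3 the three kinds of arrows have distinct
   endpoints, so there are no parallel arrows and a relation describes the
   quiver completely. *)
Definition arrow (a a' : mut) : bool :=
  [|| (a'.1 == a.1) && (a'.2 == a.2 + 1),
      (a'.1.+1 == a.1 :> nat) && (a'.2 == a.2)
    | (a'.1 == a.1.+1 :> nat) && (a'.2 == a.2 - 1)].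

(* The element (a, a') of this type is the frozen vertex v_{a,a'}. *)
Definition frozen : predArgType := {e : mut * mut | arrow e.1 e.2}.

Definition vertex : predArgType := (mut + frozen)%type.

Definition is_frozen (v : vertex) : bool := if v is inr _ then true else false.

(* The number of arrows u -> v of the enriched quiver. *)
Definition narrows (u v : vertex) : nat :=
  match u, v with
  | inl a, inl a' => arrow a a'
  | inl a', inr e => a' == (val e).2
  | inr e, inl a => a == (val e).1
  | inr _, inr _ => 0
  end.

Definition enriched_quiver (u v : vertex) : int :=
  (narrows u v)%:Z - (narrows v u)%:Z.

(* The vertex v_{a,a'}, provided a -> a' is an arrow (see [frzE]); the value
   is irrelevant otherwise. *)
Definition frz (a a' : mut) : vertex :=
  if insub (a, a') is Some e then inr e else inl a.

Lemma frzE (a a' : mut) (h : arrow a a') :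
  frz a a' = inr (exist (fun e : mut * mut => arrow e.1 e.2) (a, a') h).
Proof. by rewrite /frz insubT. Qed.

(* One variable for each vertex, mutable or frozen. *)
Definition ratfield : fieldType := {fraction {mpoly rat[#|{: vertex}|]}}.

Definition var (v : vertex) : ratfield :=
  @tofrac {mpoly rat[#|{: vertex}|]} 'X_(enum_rank v).

Record seed := Seed {
  exch : vertex -> vertex -> int;
  cluster : vertex -> ratfield
}.

Definition initial_seed : seed := Seed enriched_quiver var.

(* Equality of seeds; arrows between frozen vertices are disregarded. *)
Definition seed_eq (s t : seed) : Prop :=
  (forall u v, ~~ (is_frozen u && is_frozen v) -> exch s u v = exch t u v)
  /\ (forall v, cluster s v = cluster t v).

(* The division by 2 is exact: the dividend is 0 or +/- 2 b_{uk} b_{kv}. *)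
Definition mutate (a : mut) (s : seed) : seed :=
  let k : vertex := inl a in
  let b := exch s in
  let z := cluster s in
  Seed
    (fun u v =>
       if (u == k) || (v == k) then - b u v
       else b u v + ((`|b u k| * b k v + b u k * `|b k v|) %/ 2)%Z)
    (fun v =>
       if v == k then
         (z k)^-1 * (\prod_(u : vertex | (0 < b u k)%R) z u ^+ `|b u k|%N
                   + \prod_(u : vertex | (b u k < 0)%R) z u ^+ `|b u k|%N)
       else z v).

Definition swap (u v w : vertex) : vertex :=
  if w == u then v else if w == v then u else w.

Definition transpose (u v : vertex) (s : seed) : seed :=
  Seed (fun w w' => exch s (swap u v w) (swap u v w'))
       (fun w => cluster s (swap u v w)).

Inductive operation := Mutation of mut | Transposition of vertex & vertex.

Definition is_mutation (o : operation) : bool :=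
  if o is Mutation _ then true else false.

Definition is_transposition (o : operation) : bool :=
  if o is Transposition u v then u != v else false.

Definition perform (s : seed) (o : operation) : seed :=
  match o with
  | Mutation a => mutate a s
  | Transposition u v => transpose u v s
  end.

(* The head of the list is performed first. *)
Definition perform_all (ops : seq operation) (s : seed) : seed :=
  foldl perform s ops.

Section Row.

(* The row M_j; only 0 < j < m is meant, so that rows j - 1 and j + 1 exist. *)
Variable j : nat.

Definition mid (i : 'Z_n) : mut := (inord j, i).
Definition below (i : 'Z_n) : mut := (inord j.-1, i).
Definition above (i : 'Z_n) : mut := (inord j.+1, i).

Lemma arrow_mid_mid i : arrow (mid i) (mid (i + 1)).
Proof. by rewrite /arrow !eqxx. Qed.

Lemma arrow_mid_below i : (0 < j < m)%N -> arrow (mid i) (below i).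
Proof.
case/andP=> j0 jm; rewrite /arrow /= !inordK ?prednK ?eqxx ?orbT //.
  exact: ltnW.
by apply: leq_trans (ltnW jm) _.
Qed.

Lemma arrow_mid_above i : (0 < j < m)%N -> arrow (mid i) (above (i - 1)).
Proof.
case/andP=> j0 jm; rewrite /arrow /= !inordK ?eqxx ?orbT //.
exact: ltnW.
Qed.

Lemma arrow_below_mid i : (0 < j < m)%N -> arrow (below i) (mid (i - 1)).
Proof.
case/andP=> j0 jm; rewrite /arrow /= !inordK ?prednK ?eqxx ?orbT //.
  by apply: leq_trans (ltnW jm) _.
exact: ltnW.
Qed.

Lemma arrow_above_mid i : (0 < j < m)%N -> arrow (above i) (mid i).
Proof.
case/andP=> j0 jm; rewrite /arrow /= !inordK ?eqxx ?orbT //.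
exact: ltnW.
Qed.

Definition R_operations (k : 'Z_n) : seq operation :=
     [seq Mutation (mid (k + h%:R)) | h <- iota 0 n]
  ++ [seq Mutation (mid (k + h%:R)) | h <- rev (iota 0 (n - 2))]
  ++ [:: Transposition (inl (mid (k - 2%:R))) (inl (mid (k - 1)))]
  ++ [seq Transposition (frz (mid i) (above (i - 1))) (frz (below i) (mid (i - 1)))
     | i : 'Z_n]
  ++ [seq Transposition (frz (above i) (mid i))
                        (frz (mid (i + 1)) (below (i + 1))) | i : 'Z_n].

Let x (i : 'Z_n) : ratfield := var (inl (mid i)).
Let xm (i : 'Z_n) : ratfield := var (inl (below i)).
Let xp (i : 'Z_n) : ratfield := var (inl (above i)).
Let X (a a' : mut) : ratfield := var (frz a a').

(* The integers i <= l < i + n and h are represented by natural numbers,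
   with i : 'Z_n replaced by its representative in {0, ..., n - 1}. *)
Definition R_image (i : 'Z_n) : ratfield :=
  (\prod_(h : 'Z_n | h != i) x h)^-1 *
  \sum_(i <= l < i + n)
    (xm (l.+1)%:R
     * (\prod_(h : 'Z_n | (h != l%:R) && (h != (l.+1)%:R)) x h)
     * xp l%:R
     * X (mid l%:R) (mid (l.+1)%:R)
     * (\prod_(l.+1 <= h < i + n)
          (X (above h%:R) (mid h%:R) * X (below (h.+1)%:R) (mid h%:R)))
     * (\prod_(i.+1 <= h < l.+1)
          (X (mid h%:R) (below h%:R) * X (mid h%:R) (above (h%:R - 1))))).

Definition R_moved (v : vertex) : bool :=
  [exists i : 'Z_n, v \in [:: inl (mid i);
     frz (above i) (mid i); frz (mid (i + 1)) (below (i + 1));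
     frz (mid i) (above (i - 1)); frz (below i) (mid (i - 1))]].

(* A field endomorphism is determined by its values on the variables, so at
   most one R has this property, namely the cluster R-matrix of the row. *)
Definition is_cluster_R_matrix (R : {rmorphism ratfield -> ratfield}) : Prop :=
  [/\ forall i, R (x i) = R_image i,
      forall i, R (X (above i) (mid i)) = X (mid (i + 1)) (below (i + 1))
             /\ R (X (mid (i + 1)) (below (i + 1))) = X (above i) (mid i),
      forall i, R (X (mid i) (above (i - 1))) = X (below i) (mid (i - 1))
             /\ R (X (below i) (mid (i - 1))) = X (mid i) (above (i - 1))
    & forall v, ~~ R_moved v -> R (var v) = var v].

End Row.

End Quiver.

(* Main.v *)
Require Import Defs.
From HB Require Import structures.
From mathcomp Require Import all_boot all_order all_algebra fraction.
From mathcomp Require Import generic_quotient.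
From mathcomp Require Import mpoly.
From mathcomp Require Import ring zify.

Set Implicit Arguments.
Unset Strict Implicit.
Unset Printing Implicit Defensive.

Import Order.TTheory GRing.Theory Num.Theory.
Local Open Scope ring_scope.

(** Number the row from its vertex k and let W be the composite of the first
   n - 2 mutations, at k, ..., k + n - 3.  The last n - 2 mutations undo W,
   since mutations are involutive, and the transpositions commute with them,
   since they do not move k, ..., k + n - 3.  Hence the operation sends the
   initial seed to T, the same quiver with the R-matrix images as variables, if
   and only if the two sides agree after applying W: the seed obtained from
   W (initial seed) by mutating at k + n - 2 and k + n - 1 and transposing must
   be W (T).  This is [middle_seed_eq], an equality of two explicit seeds.

   Quivers.  A vertex outside the row is adjacent to the row in one of three
   ways: like i+1^-, i^+ and v_{i,i+1} (an arrow to i and one from i + 1), like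
   the frozen vertices of the two arrows that leave the row at i (an arrow to i),
   or like those of the two arrows that enter it at i (an arrow from i).
   The changes of the exchange matrix depend on these kinds only, which leaves
   a quiver on 4 n vertices to follow ([kind_mutate_start],
   [kind_mutate_later]).  After W the row is a path whose end k + n - 3 carries
   the two leaves k + n - 2 and k + n - 1.  Mutating at both leaves and
   exchanging them gives the same quiver back, up to the exchange of the second
   and the third kinds ([kind_mutate_last_two]), and the transpositions of
   frozen vertices realise the latter ([exch_swap]).

   Variables.  Let a_i, b_i, c_i be the products of the variables of the three
   kinds at i.  The variables produced by W obey a two-term recurrence
   ([row_var]), and the images are x_i r_i for sums r_i subject to
   b_{i+1} r_{i+1} = c_i r_i + g_i (P - Q), where g_i = a_i / (x_i x_{i+1}) and
   P, Q are the products of all b_i and of all c_i ([R_ratio_step]).  It follows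
   that W produces the same variables from T as from the initial seed
   ([row_var_invariant]), and unfolding the recurrence shows that the mutations
   at the leaves produce the images of x_{k+n-1} and x_{k+n-2} ([penultimate_R],
   [last_R]).

   Existence of the field endomorphism.  The images have to be algebraically
   independent.  A mutation acts on tuples of positive rationals as a bijection,
   so the images take any prescribed positive values at a suitable positive
   point ([mutate_dominant]).  A polynomial that vanishes at the images thus
   vanishes at all positive points and is zero ([dominant_endomorphism]). *)

(** * Rational functions and their values *)

Lemma poly_pos_point (p : {poly rat}) : p != 0 -> exists2 t, 0 < t & p.[t] != 0.
Proof.
move=> p0; pose rs := [seq (i.+1)%:R : rat | i <- iota 0 (size p)].
have urs : uniq rs.
  rewrite map_inj_uniq ?iota_uniq // => i i' /eqP.
  by rewrite eqr_nat => /eqP[].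
have : ~~ all (root p) rs.
  apply/negP => all_rs.
  by have := max_poly_roots p0 all_rs urs; rewrite size_map size_iota ltnn.
case/allPn => t /mapP[i _ ->] nr; by exists (i.+1)%:R; rewrite ?ltr0n.
Qed.

(** The passage to a univariate polynomial in the last variable loses no
   coefficient, hence is injective. *)
Lemma muni_coef (R : nzRingType) n (p : {mpoly R[n.+1]}) (m : 'X_{1..n.+1}) :
  ((muni p)`_(m ord_max))@_[multinom m (widen_ord (leqnSn n) i) | i < n] = p@_m.
Proof.
rewrite muniE coef_sum raddf_sum /=.
have coefm m' : (((p@_m' *: 'X_[[multinom (m' (widen_ord (leqnSn n) i)) | i < n]]
    *: 'X^(m' ord_max)) : {poly {mpoly R[n]}})`_(m ord_max))
      @_[multinom m (widen_ord (leqnSn n) i) | i < n]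
   = if m' == m then p@_m else 0.
  rewrite coefZ coefXn.
  have [->|ne] := eqVneq m' m.
    by rewrite eqxx mulr1 mcoeffZ mcoeffX eqxx mulr1.
  case: eqP => [emax|_]; last by rewrite mulr0 mcoeff0.
  rewrite mulr1 mcoeffZ mcoeffX.
  case: eqP => [em|_]; last by rewrite mulr0.
  case/eqP: ne; apply/mnmP => i.
  case: (unliftP ord_max i) => [i' ->|->] //.
  have -> : lift ord_max i' = widen_ord (leqnSn n) i'.
    by apply: val_inj; rewrite /= /bump leqNgt ltn_ord.
  by move/mnmP/(_ i'): em; rewrite !mnmE.
rewrite (eq_bigr _ (fun m' _ => coefm m')) -big_mkcond /=.
have [mp|mp] := boolP (m \in msupp p).
  by rewrite (big_rem m) //= eqxx big1_seq ?addr0 // => m' /andP[/eqP->];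
     rewrite mem_rem_uniq ?msupp_uniq // !inE eqxx.
by rewrite (memN_msupp_eq0 mp) big1_seq.
Qed.

(** By induction on the number of variables: a nonzero coefficient with respect
   to the last variable is nonzero at some positive point, which leaves a nonzero
   polynomial in one variable. *)
Lemma mpoly_pos_point n (p : {mpoly rat[n]}) :
  p != 0 -> exists2 a : 'I_n -> rat, (forall i, 0 < a i) & p.@[a] != 0.
Proof.
elim: n p => [|n IHn] p p0.
  exists (fun=> 1) => //.
  have [c pE] : exists c, p = c%:MP.
    exists (p@_0%MM); apply/mpolyP => m; rewrite mcoeffC.
    have -> : m = 0%MM by apply/mnmP => -[].
    by rewrite eqxx mulr1.
  by rewrite pE mevalC; apply: contra_neq p0 => c0; rewrite pE c0 mpolyC0.
have [m pm] : exists m, p@_m != 0.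
  have : msupp p != [::] by rewrite msupp_eq0.
  case E: (msupp p) => [//|m s] _; exists m.
  by rewrite -mcoeff_msupp E mem_head.
have ck : (muni p)`_(m ord_max) != 0.
  by apply: contra_neq pm => c0; rewrite -muni_coef c0 mcoeff0.
have [a apos ca] := IHn _ ck.
have q0 : map_poly (meval a) (muni p) != 0.
  apply: contra_neq ca => q0.
  by rewrite -(coef_map (meval a)) q0 coef0.
have [t tpos qt] := poly_pos_point q0.
exists (fun i => if unlift ord_max i is Some i' then a i' else t).
  by move=> i; case: unlift.
suff -> : p.@[fun i => if unlift ord_max i is Some i' then a i' else t]
   = (map_poly (meval a) (muni p)).[t] by [].
rewrite muniE raddf_sum horner_sum mevalE; apply: eq_bigr => m' _ /=.
rewrite big_ord_recr /= unlift_none.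
rewrite -mul_polyC rmorphM /= map_polyC /= map_polyXn hornerM hornerC hornerXn.
rewrite mevalZ mevalX mulrA; congr (_ * _ * _).
apply: eq_bigr => i _; rewrite mnmE.
have -> : widen_ord (leqnSn n) i = lift ord_max i.
  by apply: val_inj; rewrite /= /bump leqNgt ltn_ord.
by rewrite liftK.
Qed.

Section FractionLift.

Variables (R : idomainType) (K : fieldType) (phi : {rmorphism R -> K}).
Hypothesis phi_inj : forall p, phi p = 0 -> p = 0.

Local Notation tofrac := (@FracField.tofrac R).

Definition fraction_lift (f : {fraction R}) : K :=
  phi (\n_(repr f)) / phi (\d_(repr f)).

Lemma phi_neq0 p : p != 0 -> phi p != 0.
Proof. by apply: contra_neq => /phi_inj. Qed.

Lemma fraction_repr (f : {fraction R}) :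
  f * tofrac (\d_(repr f)) = tofrac (\n_(repr f)).
Proof.
rewrite -{1}[f]reprK; move: (repr f) => r; unlock FracField.tofrac.
rewrite -[LHS]FracField.pi_mul; apply/eqmodP => /=.
rewrite /FracField.mulf /FracField.equivf /=.
by rewrite !numden_Ratio ?oner_neq0 ?mulr1 ?denom_ratioP // mulrC.
Qed.

(** The value does not depend on the numerator and denominator that represent
   the fraction; this is what makes the lift a ring morphism. *)
Lemma fraction_lift_val (f : {fraction R}) p q :
  q != 0 -> f * tofrac q = tofrac p -> fraction_lift f = phi p / phi q.
Proof.
move=> q0 fE; have d0 := denom_ratioP (repr f).
apply/eqP; rewrite eqr_div ?phi_neq0 // -!rmorphM /=; apply/eqP.
congr (phi _); apply/eqP; rewrite -tofrac_eq !tofracM -fraction_repr -fE.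
by rewrite mulrAC.
Qed.

Lemma fraction_lift_zmod : zmod_morphism fraction_lift.
Proof.
move=> f g.
have df := denom_ratioP (repr f); have dg := denom_ratioP (repr g).
rewrite (@fraction_lift_val _ (\n_(repr f) * \d_(repr g) - \n_(repr g) * \d_(repr f))
  (\d_(repr f) * \d_(repr g))) ?mulf_neq0 //; last first.
  rewrite tofracB !tofracM -!fraction_repr; ring.
rewrite /fraction_lift rmorphB !rmorphM /=; field.
by rewrite !phi_neq0.
Qed.

Lemma fraction_lift_monoid : monoid_morphism fraction_lift.
Proof.
split.
  by rewrite (@fraction_lift_val _ 1 1) ?oner_neq0 ?mulr1 ?rmorph1 ?divr1.
move=> f g.
have df := denom_ratioP (repr f); have dg := denom_ratioP (repr g).
rewrite (@fraction_lift_val _ (\n_(repr f) * \n_(repr g))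
  (\d_(repr f) * \d_(repr g))) ?mulf_neq0 //; last first.
  rewrite !tofracM -!fraction_repr; ring.
rewrite /fraction_lift !rmorphM /=; field.
by rewrite !phi_neq0.
Qed.

HB.instance Definition _ := GRing.isZmodMorphism.Build {fraction R} K
  fraction_lift fraction_lift_zmod.
HB.instance Definition _ := GRing.isMonoidMorphism.Build {fraction R} K
  fraction_lift fraction_lift_monoid.

Lemma fraction_extension :
  exists Phi : {rmorphism {fraction R} -> K}, forall p, Phi (tofrac p) = phi p.
Proof.
exists fraction_lift => p /=.
by rewrite (@fraction_lift_val _ p 1) ?oner_neq0 ?tofrac1 ?mulr1 // rmorph1 divr1.
Qed.

End FractionLift.

Section Evaluation.

Variable n : nat.
Local Notation F := {fraction {mpoly rat[n]}}.
Local Notation tofrac := (@FracField.tofrac {mpoly rat[n]}).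

(** A relation because a value exists only if some denominator does not vanish
   at the point; [evaluates_uniq] says that it is a partial function. *)
Definition evaluates (b : 'I_n -> rat) (f : F) (c : rat) : Prop :=
  exists p q : {mpoly rat[n]},
    [/\ q.@[b] != 0, f * tofrac q = tofrac p & c * q.@[b] = p.@[b]].

Variable b : 'I_n -> rat.

Lemma evaluates_uniq f c c' : evaluates b f c -> evaluates b f c' -> c = c'.
Proof.
move=> [p [q [q0 fE cE]]] [p' [q' [q0' fE' cE']]].
have /eqP : tofrac (p * q') = tofrac (p' * q).
  by rewrite !tofracM -fE -fE' mulrAC.
rewrite tofrac_eq => /eqP /(congr1 (meval b)).
rewrite !mevalM -cE -cE' => E.
apply: (mulIf q0); apply: (mulIf q0'); rewrite E; ring.
Qed.

Lemma evaluates_poly p : evaluates b (tofrac p) p.@[b].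
Proof. by exists p, 1; rewrite meval1 tofrac1 !mulr1 oner_neq0. Qed.

Lemma evaluatesD f c g d :
  evaluates b f c -> evaluates b g d -> evaluates b (f + g) (c + d).
Proof.
move=> [p [q [q0 fE cE]]] [p' [q' [q0' fE' cE']]].
exists (p * q' + p' * q), (q * q'); rewrite mevalD !mevalM mulf_neq0 //.
rewrite tofracD !tofracM -fE -fE' -cE -cE'; split=> //; ring.
Qed.

Lemma evaluatesM f c g d :
  evaluates b f c -> evaluates b g d -> evaluates b (f * g) (c * d).
Proof.
move=> [p [q [q0 fE cE]]] [p' [q' [q0' fE' cE']]].
exists (p * p'), (q * q'); rewrite !mevalM mulf_neq0 //.
rewrite !tofracM -fE -fE' -cE -cE'; split=> //; ring.
Qed.

Lemma evaluates1 : evaluates b 1 1.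
Proof. by have := evaluates_poly 1; rewrite meval1 tofrac1. Qed.

Lemma evaluates_neq0 f c : evaluates b f c -> c != 0 -> f != 0.
Proof.
move=> ev c0; apply: contra_neq c0 => f0; apply: (evaluates_uniq ev).
by have := evaluates_poly 0; rewrite meval0 tofrac0 f0.
Qed.

Lemma evaluatesV f c : c != 0 -> evaluates b f c -> evaluates b f^-1 c^-1.
Proof.
move=> c0 ev; have f0 := evaluates_neq0 ev c0.
case: ev => p [q [q0 fE cE]]; exists q, p; rewrite -cE mulf_neq0 //.
by rewrite -fE !mulKf.
Qed.

Lemma evaluatesX f c k : evaluates b f c -> evaluates b (f ^+ k) (c ^+ k).
Proof.
move=> ev; elim: k => [|k IHk]; first by rewrite !expr0; apply: evaluates1.
by rewrite !exprS; apply: evaluatesM.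
Qed.

Lemma evaluates_prod (I : Type) (r : seq I) (P : pred I) (f : I -> F) (c : I -> rat) :
  (forall i, P i -> evaluates b (f i) (c i)) ->
  evaluates b (\prod_(i <- r | P i) f i) (\prod_(i <- r | P i) c i).
Proof.
move=> ev; elim/big_rec2: _ => [|i y1 y2 Pi]; first exact: evaluates1.
by apply: evaluatesM; apply: ev.
Qed.

Lemma evaluates_sum (I : Type) (r : seq I) (P : pred I) (f : I -> F) (c : I -> rat) :
  (forall i, P i -> evaluates b (f i) (c i)) ->
  evaluates b (\sum_(i <- r | P i) f i) (\sum_(i <- r | P i) c i).
Proof.
move=> ev; elim/big_rec2: _ => [|i y1 y2 Pi].
  by have := evaluates_poly 0; rewrite meval0 tofrac0.
by apply: evaluatesD; apply: ev.
Qed.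

Lemma evaluates_mmap p (f : 'I_n -> F) (a : 'I_n -> rat) : (forall i, evaluates b (f i) (a i)) ->
  evaluates b (mmap (tofrac \o @mpolyC n rat) f p) p.@[a].
Proof.
move=> ev; rewrite mevalE; apply: evaluates_sum => m _; apply: evaluatesM.
  by have := evaluates_poly (p@_m)%:MP; rewrite mevalC.
by apply: evaluates_prod => i _; apply: evaluatesX.
Qed.

End Evaluation.

(** If p vanishes at the f i, it vanishes at every positive a, as one sees by
   evaluating p (f) at a point where the f i take the values a i.  So p = 0, and
   the substitution of the f i in polynomials extends to fractions. *)
Lemma dominant_endomorphism n (f : 'I_n -> {fraction {mpoly rat[n]}}) :
  (forall a : 'I_n -> rat, (forall i, 0 < a i) ->
     exists b, forall i, evaluates b (f i) (a i)) ->
  exists R : {rmorphism {fraction {mpoly rat[n]}} -> {fraction {mpoly rat[n]}}},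
    forall i, R (FracField.tofrac 'X_i) = f i.
Proof.
move=> dom.
pose phi : {rmorphism {mpoly rat[n]} -> {fraction {mpoly rat[n]}}} :=
  mmap (@FracField.tofrac _ \o @mpolyC n rat) f.
have [|R RE] := @fraction_extension _ _ phi.
  move=> p phi0; apply: contraTeq isT => p0.
  have [a apos pa] := mpoly_pos_point p0.
  have [b ev] := dom a apos.
  have := evaluates_neq0 (evaluates_mmap p ev) pa.
  by rewrite -[X in X != 0]/(phi p) phi0 eqxx.
by exists R => i; rewrite RE /phi /= mmapX mmap1U.
Qed.

(** * Mutations and relabellings of seeds *)

(** The increment of b_{uv} in a mutation at k, for x = b_{uk} and y = b_{kv}. *)
Definition exch_step (x y : int) : int := ((`|x| * y + x * `|y|) %/ 2)%Z.

Lemma exch_stepE x y : exch_step x y =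
  if (0 <= x) && (0 <= y) then x * y
  else if (x <= 0) && (y <= 0) then - (x * y) else 0.
Proof.
have half (z : int) : ((z + z) %/ 2)%Z = z.
  by rewrite (_ : z + z = z * 2) ?mulzK //; ring.
rewrite /exch_step.
case: (ltP x 0) => hx; case: (ltP y 0) => hy /=.
- rewrite !ltr0_norm // !ltW //=.
  by rewrite (_ : _ + _ = - (x * y) + - (x * y)) ?half //; ring.
- rewrite (ltr0_norm hx) (ger0_norm hy) mulNr addNr div0z (ltW hx) /=.
  by case: (ltgtP y 0) hy => // -> _; rewrite mulr0 oppr0.
- rewrite (ger0_norm hx) (ltr0_norm hy) mulrN subrr div0z (ltW hy) andbT.
  by case: (ltgtP x 0) hx => //= -> _; rewrite mul0r oppr0.
- by rewrite !ger0_norm // half.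
Qed.

Lemma exch_stepNN x y : exch_step (- x) (- y) = - exch_step x y.
Proof.
rewrite !exch_stepE !oppr_ge0 !oppr_le0 mulrNN.
by case: (ltgtP x 0) => [||->]; case: (ltgtP y 0) => [||->];
  rewrite /= ?mul0r ?mulr0 ?opprK ?oppr0.
Qed.

Lemma exch_stepC x y : exch_step x y = exch_step y x.
Proof. rewrite /exch_step; congr (_ %/ _)%Z; ring. Qed.

Section SeedTheory.

Variables n m : nat.
Local Notation vertex := (vertex n m).
Local Notation seed := (seed n m).
Implicit Types (s t : seed) (u v k : vertex) (a : mut n m) (f : vertex -> vertex).

Lemma seed_eq_trans s t r : seed_eq s t -> seed_eq t r -> seed_eq s r.
Proof. by move=> [e c] [e' c']; split=> [u v h|v]; rewrite ?e ?e' ?c ?c'. Qed.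

Section Mutated.

Variable K : fieldType.
Implicit Types (B : vertex -> vertex -> int) (z : vertex -> K).

Definition exch_sum B z k : K :=
  \prod_(u : vertex | (0 < B u k)%R) z u ^+ `|B u k|%N
  + \prod_(u : vertex | (B u k < 0)%R) z u ^+ `|B u k|%N.

(** Over an arbitrary field, as the same formula governs the variables, which
   are rational functions, and their values at a point. *)
Definition mutated B z k v : K :=
  if v == k then (z k)^-1 * exch_sum B z k else z v.

Lemma exch_sum_eq B B' z z' k : B k k = 0 ->
  (forall u, B u k = B' u k) -> (forall u, u != k -> z u = z' u) ->
  exch_sum B z k = exch_sum B' z' k.
Proof.
move=> Bk eB ez; congr (_ + _); apply: eq_big => [u|u]; rewrite ?eB // -eB => Bu;
  by rewrite ez //; apply: contraTneq Bu => ->; rewrite Bk.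
Qed.

Lemma exch_sumN B z k : exch_sum (fun u v => - B u v) z k = exch_sum B z k.
Proof.
rewrite /exch_sum addrC; congr (_ + _); apply: eq_big => [u|u _];
  by rewrite ?abszN ?oppr_gt0 ?oppr_lt0.
Qed.

(** The sum of the two monomials at k is unaffected by the mutation: it does not
   involve the variable at k, and reversing the arrows exchanges its terms. *)
Lemma mutatedK B B' z k : B k k = 0 -> (forall u, B' u k = - B u k) ->
  z k != 0 -> exch_sum B z k != 0 -> mutated B' (mutated B z k) k =1 z.
Proof.
move=> Bk eB zk sk v; rewrite /mutated; case: eqP => [->|//].
rewrite eqxx.
have -> : exch_sum B' (fun v => if v == k then (z k)^-1 * exch_sum B z k else z v) k
   = exch_sum B z k.
  rewrite -exch_sumN; apply: exch_sum_eq => [|u|u /negPf->] //.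
    by rewrite eB Bk !oppr0.
  by rewrite eB opprK.
by rewrite invfM invrK -mulrA mulVf ?mulr1.
Qed.

End Mutated.

Lemma mutated_gt0 B (c : vertex -> rat) k :
  (forall v, 0 < c v) -> forall v, 0 < mutated B c k v.
Proof.
move=> c0 v; rewrite /mutated; case: eqP => // _.
rewrite mulr_gt0 ?invr_gt0 //.
by apply: addr_gt0; apply: prodr_gt0 => u _; apply: exprn_gt0.
Qed.

(** Mutation is subtraction-free, so it commutes with the evaluation at any
   point where the variables are defined and positive. *)
Lemma mutated_evaluates b B (z : vertex -> ratfield n m) c k :
  (forall v, 0 < c v) -> (forall v, evaluates b (z v) (c v)) ->
  forall v, evaluates b (mutated B z k v) (mutated B c k v).
Proof.
move=> c0 ev v; rewrite /mutated; case: eqP => // _.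
apply: evaluatesM; first by apply: evaluatesV => //; rewrite gt_eqF.
by apply: evaluatesD; apply: evaluates_prod => u _; apply: evaluatesX.
Qed.

Definition skew s := forall u v, exch s u v = - exch s v u.

Lemma skew_diag s u : skew s -> exch s u u = 0.
Proof. by move=> /(_ u u); lia. Qed.

Lemma mutate_exchE a s u v : exch (mutate a s) u v =
  if (u == inl a) || (v == inl a) then - exch s u v
  else exch s u v + exch_step (exch s u (inl a)) (exch s (inl a) v).
Proof. by []. Qed.

Lemma mutate_skew a s : skew s -> skew (mutate a s).
Proof.
move=> sk u v; rewrite !mutate_exchE orbC; case: ifP => _; rewrite (sk u v) //.
by rewrite opprD (sk u (inl a)) (sk (inl a) v) exch_stepNN exch_stepC.
Qed.

Lemma mutate_eq a s t : skew s -> seed_eq s t -> seed_eq (mutate a s) (mutate a t).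
Proof.
move=> sk [e c]; split=> [u v fr|v].
  by rewrite !mutate_exchE !e // andbF.
change (mutated (exch s) (cluster s) (inl a) v
  = mutated (exch t) (cluster t) (inl a) v).
rewrite /mutated !c; case: eqP => // _; congr (_ * _).
by apply: exch_sum_eq => [|u|//]; [exact: skew_diag | rewrite e ?andbF].
Qed.

Lemma mutateK a s : skew s -> cluster s (inl a) != 0 ->
  exch_sum (exch s) (cluster s) (inl a) != 0 ->
  seed_eq (mutate a (mutate a s)) s.
Proof.
move=> sk za0 sa0; split=> [u v _|v].
  rewrite !mutate_exchE !eqxx !orbT /=.
  by case: (_ || _); rewrite ?opprK // exch_stepNN addrK.
apply: (@mutatedK _ (exch s)) => // [|u]; first exact: skew_diag.
by rewrite mutate_exchE eqxx orbT.
Qed.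

(** Permutes the labels; a product of transpositions acts in this way. *)
Definition relabel f s : seed :=
  Seed (fun u v => exch s (f u) (f v)) (fun v => cluster s (f v)).

Lemma relabel_skew f s : skew s -> skew (relabel f s).
Proof. by move=> sk u v; apply: sk. Qed.

Lemma relabel_mutate f a s : involutive f -> f (inl a) = inl a ->
  seed_eq (relabel f (mutate a s)) (mutate a (relabel f s)).
Proof.
move=> fK fa.
have fE u : (f u == inl a) = (u == inl a).
  by rewrite -{1}fa (inj_eq (inv_inj fK)).
split=> [u v _|v]; first by rewrite /= !fE fa.
rewrite /= fE fa; case: eqP => // _; congr (_ * (_ + _));
  by rewrite (reindex_inj (inv_inj fK)).
Qed.

Definition mutations (l : seq (mut n m)) s : seed :=
  foldl (fun s a => mutate a s) s l.

Lemma mutations_skew l s : skew s -> skew (mutations l s).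
Proof. by elim: l s => //= a l IH s sk; apply: IH; apply: mutate_skew. Qed.

Lemma mutations_eq l s t : skew s -> seed_eq s t ->
  seed_eq (mutations l s) (mutations l t).
Proof.
elim: l s t => //= a l IH s t sk e; apply: IH; first exact: mutate_skew.
exact: mutate_eq.
Qed.

Lemma relabel_mutations f l s : skew s -> involutive f ->
  {in l, forall a, f (inl a) = inl a} ->
  seed_eq (relabel f (mutations l s)) (mutations l (relabel f s)).
Proof.
elim: l s => //= a l IH s sk fK fl.
apply: (seed_eq_trans (IH _ _ fK _)).
- exact: mutate_skew.
- by move=> a' a'l; apply: fl; rewrite inE a'l orbT.
- apply: mutations_eq; first exact/relabel_skew/mutate_skew.
  by apply: relabel_mutate => //; rewrite fl ?mem_head.
Qed.

(** Positive values at positive points ensure that nothing vanishes along a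
   sequence of mutations, so that all of them can be undone. *)
Definition positive_seed s := skew s /\
  forall b, (forall i, 0 < b i) -> exists2 c : vertex -> rat,
    forall v, 0 < c v & forall v, evaluates b (cluster s v) (c v).

Lemma positive_seed_neq0 s a : positive_seed s ->
  cluster s (inl a) != 0 /\ exch_sum (exch s) (cluster s) (inl a) != 0.
Proof.
move=> [sk pos]; have [//|c c0 ev] := pos (fun=> 1).
have z0 : cluster s (inl a) != 0 by apply: (evaluates_neq0 (ev _)); rewrite gt_eqF.
split; first exact: z0.
have z'0 : mutated (exch s) (cluster s) (inl a) (inl a) != 0.
  apply: evaluates_neq0 (mutated_evaluates _ _ c0 ev _) _.
  by rewrite gt_eqF ?mutated_gt0.
by apply: contra_neq z'0 => s00; rewrite /mutated eqxx s00 mulr0.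
Qed.

Lemma mutate_positive a s : positive_seed s -> positive_seed (mutate a s).
Proof.
move=> [sk pos]; split=> [|b b0]; first exact: mutate_skew.
have [c c0 ev] := pos b b0; exists (mutated (exch s) c (inl a)).
  exact: mutated_gt0.
exact: mutated_evaluates.
Qed.

Lemma mutationsK l s : positive_seed s ->
  seed_eq (mutations (rev l) (mutations l s)) s.
Proof.
elim: l s => //= a l IH s pos.
rewrite rev_cons /mutations -cats1 foldl_cat /= -!/(mutations _ _).
apply: (@seed_eq_trans _ (mutate a (mutate a s))).
  apply: mutate_eq; last exact/IH/mutate_positive.
  by do 2![apply: mutations_skew]; apply: mutate_skew; case: pos.
by have [z0 s0] := positive_seed_neq0 a pos; apply: mutateK => //; case: pos.
Qed.

(** The variables of the seed, as a map between tuples of positive rationals,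
   are onto; in particular they are algebraically independent. *)
Definition dominant_seed s := skew s /\
  forall c : vertex -> rat, (forall v, 0 < c v) -> exists2 b,
    forall i, 0 < b i & forall v, evaluates b (cluster s v) (c v).

(** To reach the values c after the mutation, reach before it the values
   obtained from c by the opposite mutation. *)
Lemma mutate_dominant a s : dominant_seed s -> dominant_seed (mutate a s).
Proof.
move=> [sk dom]; split=> [|c c0]; first exact: mutate_skew.
have sk' := mutate_skew a sk.
pose c' := mutated (exch (mutate a s)) c (inl a).
have c'0 v : 0 < c' v by apply: mutated_gt0.
have [b b0 ev] := dom c' c'0; exists b => // v.
have := mutated_evaluates (exch s) (inl a) c'0 ev v.
rewrite [X in evaluates _ _ X](_ : _ = c v) //.
apply: mutatedK; first exact: skew_diag.
- by move=> u; rewrite mutate_exchE eqxx orbT opprK.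
- by rewrite gt_eqF.
- rewrite gt_eqF //.
  by apply: addr_gt0; apply: prodr_gt0 => u _; apply: exprn_gt0.
Qed.

Lemma mutations_dominant l s : dominant_seed s -> dominant_seed (mutations l s).
Proof. by elim: l s => //= a l IH s dom; apply/IH/mutate_dominant. Qed.

Lemma relabel_dominant f s : involutive f -> dominant_seed s ->
  dominant_seed (relabel f s).
Proof.
move=> fK [sk dom]; split=> [|c c0]; first exact: relabel_skew.
have [b b0 ev] := dom (c \o f) (fun v => c0 (f v)); exists b => // v /=.
by have := ev (f v); rewrite /= fK.
Qed.

Lemma initial_skew : skew (initial_seed n m).
Proof. by move=> u v; rewrite /= /enriched_quiver opprB. Qed.

Lemma var_evaluates b v : evaluates b (var v) (b (enum_rank v)).
Proof. by have := evaluates_poly b 'X_(enum_rank v); rewrite mevalXU. Qed.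

Lemma initial_dominant : dominant_seed (initial_seed n m).
Proof.
split=> [|c c0]; first exact: initial_skew.
exists (fun i => c (enum_val i)) => // v.
by have := var_evaluates (fun i => c (enum_val i)) v; rewrite enum_rankK.
Qed.

Lemma dominant_seed_endomorphism s : dominant_seed s ->
  exists R : {rmorphism ratfield n m -> ratfield n m},
    forall v, R (var v) = cluster s v.
Proof.
move=> [_ dom].
have [|R RE] := @dominant_endomorphism _ (fun i => cluster s (enum_val i)).
  move=> c c0; have [b b0 ev] := dom (fun v => c (enum_rank v)) (fun v => c0 _).
  by exists b => i; have := ev (enum_val i); rewrite enum_valK.
by exists R => v; rewrite /var RE enum_rankK.
Qed.

End SeedTheory.

(** * The quiver seen from the row *)

Ltac without_if a b :=
  lazymatch constr:((a, b)) with
  | context [if _ then _ else _] => fail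
  | _ => idtac
  end.

(** Splits on the comparisons of numbers in the goal.  Pruning the branches that
   contradict earlier comparisons keeps their number small, and conditions that
   contain a conditional are left until this one is resolved. *)
Ltac decide_atoms :=
  repeat (match goal with
  | |- context [@eq_op ?T ?a ?b] => without_if a b; case: (@eqP T a b) => ?
  | |- context [leq ?a ?b] => without_if a b; case: (leqP a b) => ?
  end; rewrite ?andbF ?orbT /=; try (exfalso; lia)); try lia.

(** The kinds of vertices, with their positions in the row.  In the initial
   quiver, a vertex of kind [Along i] has an arrow to the vertex i of the row and
   one from i + 1, a vertex of kind [Into i] has an arrow to i, one of kind
   [From i] has an arrow from i, and the row is an oriented cycle. *)
Inductive kind := Row of nat | Along of nat | Into of nat | From of nat | Apart.

Definition kind_code (u : kind) : nat * nat :=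
  match u with
  | Row i => (0, i) | Along i => (1, i) | Into i => (2, i) | From i => (3, i)
  | Apart => (4, 0)
  end%N.

Definition kind_decode (c : nat * nat) : kind :=
  match c.1 with
  | 0 => Row c.2 | 1 => Along c.2 | 2 => Into c.2 | 3 => From c.2 | _ => Apart
  end%N.

Lemma kind_codeK : cancel kind_code kind_decode.
Proof. by case. Qed.

HB.instance Definition _ := Equality.copy kind (can_type kind_codeK).

Lemma kind_eqE (u v : kind) : (u == v) =
  match u, v with
  | Row i, Row h | Along i, Along h | Into i, Into h | From i, From h => i == h
  | Apart, Apart => true
  | _, _ => false
  end.
Proof. by case: u v => [i|i|i|i|] [h|h|h|h|]. Qed.

Definition position (u : kind) : nat := (kind_code u).2.

(** The matrices at hand are skew-symmetric, so that half of the pairs of kinds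
   suffice. *)
Lemma kind_wlog (P : kind -> kind -> Prop) :
  (forall u v, P u v -> P v u) ->
  (forall u v, ((kind_code u).1 <= (kind_code v).1)%N -> P u v) ->
  forall u v, P u v.
Proof.
by move=> sym le u v; case: (leqP (kind_code u).1 (kind_code v).1) => [|/ltnW] /le // /sym.
Qed.

Section KindQuiver.

Variable n : nat.
Hypothesis n3 : (2 < n)%N.

Definition cyc_next i := if i.+1 == n then 0%N else i.+1.

Definition start_arrow (u v : kind) : bool :=
  match u, v with
  | Row i, Row h => h == cyc_next i
  | Along i, Row h => h == i
  | Row h, Along i => h == cyc_next i
  | Into i, Row h => h == i
  | Row h, From i => h == i
  | _, _ => false
  end.

(** The arrows after mutations at the positions 0, ..., t - 1 of the row.  Its
   first t vertices form a path, t - 1, n - 1 and t an oriented triangle, and n - 1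
   closes the cycle through t, ..., n - 2.  The arrows in both directions between
   n - 1 and t = n - 2 cancel in [mutated_matrix]. *)
Definition mutated_arrows (t : nat) (u v : kind) : nat :=
  match u, v with
  | Row i, Row h =>
      ((h == i.+1) && (h < t)) + ((i.+1 == t) && (h.+1 == n))
      + ((i == t) && (h.+1 == t)) + ((i.+1 == n) && (h == t))
      + ((h == i.+1) && (t <= i))
  | Along i, Row h =>
      ((i < t) && (h.+1 == i)) + ((i.+1 == n) && (h == 0))
      + ((h == i) && (t <= i) && (i.+1 < n))
  | Row h, Along i =>
      ((h == i) && (i < t)) + ((h == i.+1) && (t <= i) && (i.+1 < n))
  | Into i, Row h =>
      ((i < t) && (h.+1 == i)) + ((i < t) && (h == t)) + ((h == i) && (t <= i))
  | Row h, Into i => (i < t) && (h.+1 == t)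
  | From i, Row h => (h == i) && (i < t)
  | Row h, From i => ((i < t) && (h.+1 == n)) + ((h == i) && (t <= i))
  | Along i, From h => (i == h) && (i < t)
  | Into i, From h => (i <= h) && (h < t)
  | Along i, Along h | Into i, Along h => (i == 0) && (h.+1 == n)
  | _, _ => 0
  end%N.

Definition start_matrix (u v : kind) : int :=
  (start_arrow u v)%:Z - (start_arrow v u)%:Z.

Definition mutated_matrix (t : nat) (u v : kind) : int :=
  (mutated_arrows t u v)%:Z - (mutated_arrows t v u)%:Z.

Definition kind_mutate (B : kind -> kind -> int) (k u v : kind) : int :=
  if (u == k) || (v == k) then - B u v
  else B u v + exch_step (B u k) (B k v).

Lemma exch_step_sign (a b c d : bool) : ~~ (a && b) -> ~~ (c && d) ->
  exch_step (a%:Z - b%:Z) (d%:Z - c%:Z) = (a && d)%:Z - (b && c)%:Z.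
Proof. by case: a b c d => [] [] [] []. Qed.

(** In a column with entries in -1, 0, 1, a mutation adds an arrow for each
   path of length 2 through the mutated vertex. *)
Lemma kind_mutateE B k (inn out : pred kind) u v :
  (forall u v, B u v = - B v u) ->
  (forall u, ~~ (inn u && out u)) -> B u k = (inn u)%:Z - (out u)%:Z ->
  B v k = (inn v)%:Z - (out v)%:Z ->
  kind_mutate B k u v = if (u == k) || (v == k) then - B u v else
    B u v + ((inn u && out v)%:Z - (out u && inn v)%:Z).
Proof.
move=> sk ex Bu Bv; rewrite /kind_mutate; case: ifP => // _.
by rewrite Bu (sk k v) Bv opprB exch_step_sign.
Qed.

Lemma start_matrix_skew u v : start_matrix u v = - start_matrix v u.
Proof. by rewrite /start_matrix opprB. Qed.

Lemma mutated_matrix_skew t u v : mutated_matrix t u v = - mutated_matrix t v u.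
Proof. by rewrite /mutated_matrix opprB. Qed.

Lemma kind_mutate_skew B k : (forall u v, B u v = - B v u) ->
  forall u v, kind_mutate B k u v = - kind_mutate B k v u.
Proof.
move=> sk u v; rewrite /kind_mutate orbC (sk u v) (sk u k) (sk k v).
by case: ifP => // _; rewrite opprD exch_stepNN exch_stepC.
Qed.

(** Here and below, the kinds with entry 1 and with entry -1 in the column of the
   vertex to be mutated. *)
Definition first_in (u : kind) := match u with
  | Row i => i.+1 == n | Along i | Into i => i == 0 | _ => false end%N.
Definition first_out (u : kind) := match u with
  | Row i => i == 1 | Along i => i.+1 == n | From i => i == 0 | _ => false end%N.

Lemma start_column u : (position u < n)%N ->
  start_matrix u (Row 0) = (first_in u)%:Z - (first_out u)%:Z.
Proof.
case: u => [i|i|i|i|];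
  rewrite /start_matrix /start_arrow /first_in /first_out /position /cyc_next /=;
  decide_atoms.
Qed.

Lemma first_disjoint u : ~~ (first_in u && first_out u).
Proof. case: u => [i|i|i|i|]; rewrite /first_in /first_out; decide_atoms. Qed.

Definition later_in t (u : kind) := match u with
  | Row i => i.+1 == n | Along i => i == t | Into i => i <= t | _ => false end%N.
Definition later_out t (u : kind) := match u with
  | Row i => (i.+1 == t) || (i == t.+1) | From i => i == t | _ => false end%N.

Lemma later_column t u : (0 < t)%N -> (t.+2 < n)%N -> (position u < n)%N ->
  mutated_matrix t u (Row t) = (later_in t u)%:Z - (later_out t u)%:Z.
Proof.
move=> t0 tn; case: u => [i|i|i|i|];
  rewrite /mutated_matrix /mutated_arrows /later_in /later_out /position /=; decide_atoms.
Qed.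

Lemma later_disjoint t u : (0 < t)%N -> (t.+2 < n)%N ->
  ~~ (later_in t u && later_out t u).
Proof. move=> t0 tn; case: u => [i|i|i|i|]; rewrite /later_in /later_out; decide_atoms. Qed.

Lemma kind_mutate_start u v : (position u < n)%N -> (position v < n)%N ->
  kind_mutate start_matrix (Row 0) u v = mutated_matrix 1 u v.
Proof.
move: u v; apply: kind_wlog => [u v sym vn un|u v uv un vn].
  by rewrite (kind_mutate_skew _ start_matrix_skew) mutated_matrix_skew sym.
rewrite (kind_mutateE start_matrix_skew first_disjoint) ?start_column //.
case: u v uv un vn => [i|i|i|i|] [h|h|h|h|] // _;
  rewrite /position /start_matrix /mutated_matrix /start_arrow /mutated_arrows
   /first_in /first_out /cyc_next /= ?kind_eqE /=; decide_atoms.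
Qed.

Lemma kind_mutate_later t u v : (0 < t)%N -> (t.+2 < n)%N ->
  (position u < n)%N -> (position v < n)%N ->
  kind_mutate (mutated_matrix t) (Row t) u v = mutated_matrix t.+1 u v.
Proof.
move=> t0 tn; move: u v; apply: kind_wlog => [u v sym vn un|u v uv un vn].
  by rewrite (kind_mutate_skew _ (mutated_matrix_skew t)) mutated_matrix_skew sym.
rewrite (kind_mutateE (mutated_matrix_skew t) (inn := later_in t)
  (out := later_out t)) ?later_column // => [|w]; last exact: later_disjoint.
case: u v uv un vn => [i|i|i|i|] [h|h|h|h|] // _;
  rewrite /position /mutated_matrix /mutated_arrows
   /later_in /later_out /= ?kind_eqE /=; decide_atoms.
Qed.

Definition cyc_prev i := if i == 0%N then n.-1 else i.-1.

Definition kind_swap (u : kind) : kind :=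
  match u with
  | Row i => Row (if i.+2 == n then i.+1 else if i.+1 == n then i.-1 else i)
  | Into i => From (cyc_prev i)
  | From i => Into (cyc_next i)
  | _ => u
  end.

(** The transpositions of frozen vertices change the arrows that do not meet
   the row: each of these frozen vertices is attached to one of the two outer
   vertices along the same edge of the row, and the transposition attaches it to
   the other one.  This is the resulting change. *)
Definition swap_defect (u v : kind) : bool :=
  match u, v with
  | Along i, From h => h == i
  | Into h, Along i => h == cyc_next i
  | _, _ => false
  end.

(** The kinds whose vertices are all frozen. *)
Definition kind_frozen (u : kind) : bool :=
  match u with Into _ | From _ => true | _ => false end.

Lemma kind_swap_position u : (position u < n)%N -> (position (kind_swap u) < n)%N.
Proof.
case: u => [i|i|i|i|]; rewrite /kind_swap /position /cyc_prev /cyc_next //=;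
  decide_atoms.
Qed.

Section LastTwo.

Variable t : nat.
Hypothesis tn : t.+2 = n.

Definition last_in0 (u : kind) := match u with
  | Along i => i == t | Into i => i <= t | _ => false end%N.
Definition last_out0 (u : kind) := match u with
  | Row i => i.+1 == t | From i => i == t | _ => false end%N.
Definition last_in1 (u : kind) := match u with
  | Row i => i.+1 == t | Into i => i == t.+1 | _ => false end%N.
Definition last_out1 (u : kind) := match u with
  | Along i => i == t | From i => (i < t) || (i == t.+1) | _ => false end%N.

Lemma last_column0 u : (position u < n)%N ->
  mutated_matrix t u (Row t) = (last_in0 u)%:Z - (last_out0 u)%:Z.
Proof.
case: u => [i|i|i|i|];
  rewrite /mutated_matrix /mutated_arrows /last_in0 /last_out0 /position /=; decide_atoms.
Qed.

Lemma last_disjoint0 u : ~~ (last_in0 u && last_out0 u).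
Proof. case: u => [i|i|i|i|]; rewrite /last_in0 /last_out0; decide_atoms. Qed.

Lemma last_disjoint1 u : ~~ (last_in1 u && last_out1 u).
Proof. case: u => [i|i|i|i|]; rewrite /last_in1 /last_out1; decide_atoms. Qed.

Local Notation B0 := (mutated_matrix t).
Local Notation B1 := (kind_mutate B0 (Row t)).

Lemma last_mutateE0 u v : (position u < n)%N -> (position v < n)%N ->
  B1 u v = if (u == Row t) || (v == Row t) then - B0 u v
    else B0 u v + ((last_in0 u && last_out0 v)%:Z - (last_out0 u && last_in0 v)%:Z).
Proof.
move=> un vn.
exact: kind_mutateE (mutated_matrix_skew t) last_disjoint0
  (last_column0 un) (last_column0 vn).
Qed.

Lemma last_column1 u : (position u < n)%N ->
  B1 u (Row t.+1) = (last_in1 u)%:Z - (last_out1 u)%:Z.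
Proof.
move=> un; rewrite last_mutateE0 //; last by rewrite /position /= -tn.
case: u un => [i|i|i|i|]; rewrite /mutated_matrix /mutated_arrows /last_in0
  /last_out0 /last_in1 /last_out1 /position /= ?kind_eqE /=;
  decide_atoms.
Qed.

(** The leaves t and t + 1 play symmetric roles: mutating at both and exchanging
   them acts as the exchange of [Into (i + 1)] and [From i]. *)
Lemma kind_mutate_last_two u v : (position u < n)%N -> (position v < n)%N ->
  ~~ (kind_frozen u && kind_frozen v) ->
  kind_mutate B1 (Row t.+1) (kind_swap u) (kind_swap v)
    + (swap_defect u v)%:Z - (swap_defect v u)%:Z = B0 u v.
Proof.
move: u v; apply: kind_wlog => [u v sym vn un fr|u v uv].
  rewrite (kind_mutate_skew _ (kind_mutate_skew _ (mutated_matrix_skew t))).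
  by rewrite mutated_matrix_skew -sym // 1?andbC //; ring.
move=> /[dup] un /kind_swap_position un' /[dup] vn /kind_swap_position vn'.
rewrite (kind_mutateE (kind_mutate_skew _ (mutated_matrix_skew t)) last_disjoint1
  (last_column1 un') (last_column1 vn')) last_mutateE0 //.
case: u v uv un vn {un' vn'} => [i|i|i|i|] [h|h|h|h|] // _;
  rewrite /position /kind_swap /swap_defect /mutated_matrix /mutated_arrows
   /cyc_prev /cyc_next /last_in0 /last_out0 /last_in1 /last_out1 /= ?kind_eqE /=;
  decide_atoms.
Qed.

End LastTwo.

End KindQuiver.

(** * Kinds of the vertices of the grid *)

Section Grid.

Variables (d m j : nat) (k : 'Z_d.+3).
Hypothesis jm : (0 < j < m)%N.

Local Notation n := d.+3.
Local Notation mut := (mut n m).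
Local Notation vertex := (vertex n m).
Local Notation mid := (@mid n m j).
Local Notation below := (@below n m j).
Local Notation above := (@above n m j).
Implicit Types (i : 'Z_n) (a : mut) (u v : vertex).

(** Positions are counted from the vertex where the mutations start. *)
Definition pos i : nat := val (i - k).

Lemma pos_lt i : (pos i < n)%N.
Proof. exact: ltn_ord. Qed.

Lemma pos_inj : injective pos.
Proof. by move=> i i' /val_inj /(addIr (- k)). Qed.

Lemma val_Zp_succ i : val (i + 1) = cyc_next n (val i).
Proof.
rewrite /= addn1 /cyc_next; case: eqP => [->|/eqP ne]; first by rewrite modnn.
by rewrite modn_small // ltn_neqAle ne ltn_ord.
Qed.

Lemma pos_succ i : pos (i + 1) = cyc_next n (pos i).
Proof. by rewrite /pos addrAC val_Zp_succ. Qed.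

Lemma pos_eq_next i i' : (pos i == cyc_next n (pos i')) = (i == i' + 1).
Proof. by rewrite -pos_succ (inj_eq pos_inj). Qed.

Lemma pos_shift h : (h < n)%N -> pos (k + h%:R) = h.
Proof.
move=> hn; rewrite /pos addrAC subrr add0r.
by rewrite -[LHS]/(nat_of_ord (h%:R : 'Z_n)) val_Zp_nat // modn_small.
Qed.

Lemma shift_pos i : k + (pos i)%:R = i.
Proof. by apply: pos_inj; rewrite pos_shift ?pos_lt. Qed.

Lemma mid_row i : (mid i).1 = j :> nat.
Proof. by rewrite inordK //; move: jm; lia. Qed.

Lemma below_row i : (below i).1 = j.-1 :> nat.
Proof. by rewrite inordK //; move: jm; lia. Qed.

Lemma above_row i : (above i).1 = j.+1 :> nat.
Proof. by rewrite inordK //; move: jm; lia. Qed.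

Lemma mutP a i (r : 'I_m.+1) : (a == (r, i)) = (a.1 == r :> nat) && (a.2 == i).
Proof. by case: a => a1 a2; rewrite xpair_eqE -val_eqE. Qed.

Lemma mid_eq a i : (a == mid i) = (a.1 == j :> nat) && (a.2 == i).
Proof. by rewrite mutP -[nat_of_ord (inord _)]/(nat_of_ord (mid i).1) mid_row. Qed.

Lemma below_eq a i : (a == below i) = (a.1 == j.-1 :> nat) && (a.2 == i).
Proof. by rewrite mutP -[nat_of_ord (inord _)]/(nat_of_ord (below i).1) below_row. Qed.

Lemma above_eq a i : (a == above i) = (a.1 == j.+1 :> nat) && (a.2 == i).
Proof. by rewrite mutP -[nat_of_ord (inord _)]/(nat_of_ord (above i).1) above_row. Qed.

Definition kind_mut a : kind :=
  if a.1 == j :> nat then Row (pos a.2)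
  else if a.1 == j.-1 :> nat then Along (pos (a.2 - 1))
  else if a.1 == j.+1 :> nat then Along (pos a.2)
  else Apart.

Definition kind_arrow (b b' : mut) : kind :=
  if b.1 == j :> nat then
    if b'.1 == j :> nat then Along (pos b.2) else Into (pos b.2)
  else if b'.1 == j :> nat then From (pos b'.2) else Apart.

Definition kind_of v : kind :=
  match v with
  | inl a => kind_mut a
  | inr e => kind_arrow (val e).1 (val e).2
  end.

Lemma kind_of_position v : (position (kind_of v) < n)%N.
Proof.
case: v => [a|e]; rewrite /kind_of /kind_mut /kind_arrow /position;
  by do !case: ifP => _; rewrite /= ?pos_lt.
Qed.

Lemma kind_of_frz (b b' : mut) : arrow b b' -> kind_of (frz b b') = kind_arrow b b'.
Proof. by move=> h; rewrite (frzE h). Qed.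

Definition on_row v : bool := if v is inl a then a.1 == j :> nat else false.

Lemma kind_of_row v i : (kind_of v == Row (pos i)) = (v == inl (mid i)).
Proof.
case: v => [a|e] /=.
  rewrite -[RHS]/(a == mid i) mid_eq /kind_mut; case: (a.1 == j :> nat);
    rewrite /= ?kind_eqE ?(inj_eq pos_inj) //=.
  by do !case: ifP => _.
by rewrite /kind_arrow; do !case: ifP => _.
Qed.

(** The part of the exchange matrix that mutations in the row change only
   through the kinds of the two vertices. *)
Definition outer_matrix u v : int :=
  if on_row u || on_row v then 0 else enriched_quiver u v.

Lemma arrow_in_row (b b' : mut) :
  arrow b b' -> b.1 = b'.1 :> nat -> b'.2 = b.2 + 1.
Proof.
move=> h e; move: h; rewrite /arrow -val_eqE /= e eqxx /=.
have -> : (b'.1.+1 == b'.1 :> nat) = false by lia.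
have -> : (b'.1 == b'.1.+1 :> nat) = false by lia.
by rewrite orbF => /eqP.
Qed.

(** This reduces the mutations in the row to mutations of a matrix of kinds. *)
Lemma narrows_kind u v : on_row u || on_row v ->
  narrows u v = start_arrow n (kind_of u) (kind_of v) :> nat.
Proof.
have j0 : (0 < j)%N by case/andP: jm.
case: u v => [a|[[b b'] /= h]] [c|[[e e'] /= h']] //=; rewrite ?orbF.
- rewrite /arrow /kind_mut; case: (eqVneq (a.1 : nat) j) => aj /=;
    case: (eqVneq (c.1 : nat) j) => cj //= _.
  + rewrite (_ : c.1 == a.1); last by apply/eqP/val_inj; rewrite /= aj.
    rewrite pos_eq_next aj cj /=.
    have -> : (j.+1 == j) = false by lia.
    have -> : (j == j.+1) = false by lia.
    by rewrite /= orbF.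
  + rewrite (_ : (c.1 == a.1) = false); last by rewrite -val_eqE /= aj (negPf cj).
    rewrite aj /=; have -> : (c.1.+1 == j) = (c.1 == j.-1 :> nat) by lia.
    case: eqP => c1 /=.
      rewrite pos_eq_next subrK eq_sym.
      by rewrite (_ : (c.1 == j.+1 :> nat) = false) ?orbF //; lia.
    case: eqP => c2 //=; by rewrite pos_eq_next eq_sym subr_eq.
  + rewrite (_ : (c.1 == a.1) = false); last by rewrite -val_eqE /= cj eq_sym (negPf aj).
    rewrite cj /=; have -> : (j.+1 == a.1 :> nat) = (a.1 == j.+1 :> nat) by lia.
    have -> : (j == a.1.+1 :> nat) = (a.1 == j.-1 :> nat) by lia.
    case: (eqVneq (a.1 : nat) j.-1) => a1 /=.
      rewrite (inj_eq pos_inj).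
      by rewrite (_ : (a.1 == j.+1 :> nat) = false) ?orbF //; lia.
    case: eqP => c2 //=; by rewrite (inj_eq pos_inj) orbF.
- move=> aj; rewrite /kind_mut aj /kind_arrow -[a == e']/(a == (e'.1, e'.2)) mutP.
  rewrite (eqP aj).
  case: (eqVneq (e.1 : nat) j) => ej; case: (eqVneq (e'.1 : nat) j) => e'j;
    rewrite ?e'j ?eqxx /= 1?eq_sym ?(negPf e'j) //=; last by rewrite (inj_eq pos_inj) eq_sym.
  by rewrite pos_eq_next -(arrow_in_row h') ?ej ?e'j // eq_sym.
- move=> cj; rewrite /kind_mut cj /kind_arrow -[c == b]/(c == (b.1, b.2)) mutP.
  rewrite (eqP cj).
  case: (eqVneq (b.1 : nat) j) => bj; case: (eqVneq (b'.1 : nat) j) => b'j;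
    rewrite ?bj ?eqxx /= 1?eq_sym ?(negPf bj) //=; by rewrite (inj_eq pos_inj) eq_sym.
Qed.

Lemma start_kind u v :
  enriched_quiver u v = outer_matrix u v + start_matrix n (kind_of u) (kind_of v).
Proof.
rewrite /outer_matrix; case: ifP => [h|h].
  rewrite add0r /start_matrix /enriched_quiver narrows_kind //.
  by rewrite (narrows_kind (u := v)) // orbC.
suff -> : start_matrix n (kind_of u) (kind_of v) = 0 by rewrite addr0.
have outer w : ~~ on_row w -> forall p, kind_of w <> Row p.
  case: w => [a|e] /=; rewrite /kind_mut /kind_arrow => wr p.
    by rewrite (negPf wr); do !case: ifP => _.
  by do !case: ifP => _.
case/norP: (negbT h) => /outer hu /outer hv.
rewrite /start_matrix; case: (kind_of u) (kind_of v) hu hv =>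
  [p|p|p|p|] [q|q|q|q|] hu hv //=; by [case: (hu p) | case: (hv q)].
Qed.

(** The shape of the exchange matrices reached from the initial one by mutations
   in the row. *)
Definition kind_form (s : seed n m) (B : kind -> kind -> int) :=
  forall u v, exch s u v = outer_matrix u v + B (kind_of u) (kind_of v).

Lemma kind_form_start (z : vertex -> ratfield n m) :
  kind_form (Seed (@enriched_quiver n m) z) (start_matrix n).
Proof. exact: start_kind. Qed.

Lemma kind_form_mutate s B i : kind_form s B ->
  kind_form (mutate (mid i) s) (kind_mutate B (Row (pos i))).
Proof.
move=> sB u v; rewrite mutate_exchE /kind_mutate !kind_of_row !sB.
have row : on_row (inl (mid i)) by rewrite /on_row mid_row.
have outu w : outer_matrix w (inl (mid i)) = 0 by rewrite /outer_matrix row orbT.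
have outv w : outer_matrix (inl (mid i)) w = 0 by rewrite /outer_matrix row.
have /eqP kr : kind_of (inl (mid i)) == Row (pos i) by rewrite kind_of_row.
rewrite !outu !outv !kr !add0r.
case: ifP => [/orP|_]; last by rewrite addrA.
case => /eqP->.
  by rewrite outv !add0r.
by rewrite outu !add0r.
Qed.

Lemma kind_form_eq s B B' : kind_form s B ->
  (forall p q, (position p < n)%N -> (position q < n)%N -> B p q = B' p q) ->
  kind_form s B'.
Proof. by move=> sB eB u v; rewrite sB eB ?kind_of_position. Qed.

Inductive frozen_spec : vertex -> Prop :=
 | FrozenAlong i : frozen_spec (frz (mid i) (mid (i + 1)))
 | FrozenToBelow i : frozen_spec (frz (mid i) (below i))
 | FrozenToAbove i : frozen_spec (frz (mid i) (above (i - 1)))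
 | FrozenFromBelow i : frozen_spec (frz (below i) (mid (i - 1)))
 | FrozenFromAbove i : frozen_spec (frz (above i) (mid i))
 | FrozenApart (e : frozen n m) of (val e).1.1 != j :> nat & (val e).2.1 != j :> nat :
     frozen_spec (inr e).

Lemma frozenP (e : frozen n m) : frozen_spec (inr e).
Proof.
case: (eqVneq ((val e).1.1 : nat) j) => ej; last first.
  case: (eqVneq ((val e).2.1 : nat) j) => e'j; last exact: FrozenApart.
  case: e ej e'j => -[b b'] h /= bj /eqP b'j.
  have : (b == below (b'.2 + 1)) || (b == above b'.2).
    rewrite below_eq above_eq; move: (h); rewrite /arrow /=.
    rewrite -val_eqE /= (eqP b'j) => /or3P[/andP[/eqP e _]|/andP[/eqP<- /eqP->]|].
    - by rewrite e eqxx in bj.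
    - by rewrite !eqxx orbT.
    - by move=> /andP[/eqP-> /eqP->]; rewrite subrK !eqxx.
  move: b'j; have := mid_eq b' b'.2; rewrite eqxx andbT => <- /eqP b'E.
  case/orP => /eqP bE.
    have := FrozenFromBelow (b'.2 + 1); rewrite addrK -b'E -bE (frzE h).
    by [].
  by have := FrozenFromAbove b'.2; rewrite -b'E -bE (frzE h).
case: e ej => -[b b'] h /= /eqP bj.
have : [|| b' == mid (b.2 + 1), b' == below b.2 | b' == above (b.2 - 1)].
  rewrite mid_eq below_eq above_eq; move: (h); rewrite /arrow /=.
  rewrite -val_eqE /= (eqP bj).
  case/or3P => /andP[/eqP e /eqP->]; rewrite eqxx ?andbT.
  - by rewrite e eqxx.
  - by rewrite (_ : b'.1 == j.-1 :> nat) ?orbT //; lia.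
  - by rewrite e eqxx !orbT.
move: bj; have := mid_eq b b.2; rewrite eqxx andbT => <- /eqP bE.
case/or3P => /eqP b'E.
- by have := FrozenAlong b.2; rewrite -b'E -bE (frzE h).
- by have := FrozenToBelow b.2; rewrite -b'E -bE (frzE h).
- by have := FrozenToAbove b.2; rewrite -b'E -bE (frzE h).
Qed.

Definition frozen_swap (b b' : mut) v : vertex :=
  if b.1 == j :> nat then
    if b'.1 == j :> nat then v
    else if b' == below b.2 then frz (above (b.2 - 1)) (mid (b.2 - 1))
    else frz (below b.2) (mid (b.2 - 1))
  else if b'.1 == j :> nat then
    if b == above b'.2 then frz (mid (b'.2 + 1)) (below (b'.2 + 1))
    else frz (mid (b'.2 + 1)) (above b'.2)
  else v.

(** The product of all the transpositions of the operation, which are disjoint. *)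
Definition vertex_swap v : vertex :=
  match v with
  | inl a => if a == mid (k - 2%:R) then inl (mid (k - 1))
             else if a == mid (k - 1) then inl (mid (k - 2%:R)) else inl a
  | inr e => frozen_swap (val e).1 (val e).2 v
  end.

Lemma vertex_swap_frz (b b' : mut) : arrow b b' ->
  vertex_swap (frz b b') = frozen_swap b b' (frz b b').
Proof. by move=> h; rewrite (frzE h). Qed.

Lemma arrow_down i : arrow (below (i + 1)) (mid i).
Proof. by rewrite -{2}(addrK 1 i) arrow_below_mid. Qed.

Lemma row_neq : ((j.-1 == j) = false) * ((j.+1 == j) = false)
  * ((j.-1 == j.+1) = false) * ((j.+1 == j.-1) = false).
Proof. by move: jm; do !split; lia. Qed.

Lemma below_neq_above i i' : (below i == above i') = false.
Proof. by rewrite above_eq below_row row_neq. Qed.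

Lemma above_neq_below i i' : (above i == below i') = false.
Proof. by rewrite eq_sym below_neq_above. Qed.

Lemma vertex_swap_along i :
  vertex_swap (frz (mid i) (mid (i + 1))) = frz (mid i) (mid (i + 1)).
Proof. by rewrite vertex_swap_frz ?arrow_mid_mid // /frozen_swap !mid_row eqxx. Qed.

Lemma vertex_swap_to_below i :
  vertex_swap (frz (mid i) (below i)) = frz (above (i - 1)) (mid (i - 1)).
Proof.
by rewrite vertex_swap_frz ?arrow_mid_below // /frozen_swap mid_row below_row eqxx row_neq eqxx.
Qed.

Lemma vertex_swap_to_above i :
  vertex_swap (frz (mid i) (above (i - 1))) = frz (below i) (mid (i - 1)).
Proof.
rewrite vertex_swap_frz ?arrow_mid_above // /frozen_swap mid_row above_row eqxx.
by rewrite row_neq above_neq_below.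
Qed.

Lemma vertex_swap_from_below i :
  vertex_swap (frz (below i) (mid (i - 1))) = frz (mid i) (above (i - 1)).
Proof.
rewrite vertex_swap_frz ?arrow_below_mid // /frozen_swap mid_row below_row eqxx.
by rewrite row_neq below_neq_above subrK.
Qed.

Lemma vertex_swap_from_above i :
  vertex_swap (frz (above i) (mid i)) = frz (mid (i + 1)) (below (i + 1)).
Proof.
rewrite vertex_swap_frz ?arrow_above_mid // /frozen_swap mid_row above_row eqxx.
by rewrite row_neq eqxx.
Qed.

Lemma vertex_swap_apart (e : frozen n m) :
  (val e).1.1 != j :> nat -> (val e).2.1 != j :> nat ->
  vertex_swap (inr e) = inr e.
Proof. by rewrite /vertex_swap /frozen_swap => /negPf-> /negPf->. Qed.

Lemma mid_inj : injective mid.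
Proof. by move=> i i' []. Qed.

Lemma pos_pred i : pos (i - 1) = cyc_prev n (pos i).
Proof.
rewrite -{2}(subrK 1 i) pos_succ /cyc_next /cyc_prev.
by case: (eqVneq (pos (i - 1)).+1 n) => [[->]|_].
Qed.

Lemma pos_base : pos k = 0%N.
Proof. by rewrite /pos subrr. Qed.

Lemma pos_last : pos (k - 1) = d.+2.
Proof. by rewrite pos_pred pos_base. Qed.

Lemma pos_last2 : pos (k - 2%:R) = d.+1.
Proof. by rewrite (_ : 2%:R = 1 + 1) // opprD addrA pos_pred pos_last. Qed.

Lemma vertex_swapK : involutive vertex_swap.
Proof.
case=> [a|e].
  have ne : (mid (k - 1) == mid (k - 2%:R)) = false.
    by rewrite (inj_eq mid_inj) -(inj_eq pos_inj) pos_last pos_last2; lia.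
  rewrite {2}/vertex_swap; case: (eqVneq a (mid (k - 2%:R))) => [->|a2].
    by rewrite /vertex_swap ne eqxx.
  case: (eqVneq a (mid (k - 1))) => [->|a1]; first by rewrite /vertex_swap eqxx.
  by rewrite /vertex_swap (negPf a1) (negPf a2).
case: (frozenP e) => [i|i|i|i|i|e' h h'].
- by rewrite !vertex_swap_along.
- by rewrite vertex_swap_to_below vertex_swap_from_above subrK.
- by rewrite vertex_swap_to_above vertex_swap_from_below.
- by rewrite vertex_swap_from_below vertex_swap_to_above.
- by rewrite vertex_swap_from_above vertex_swap_to_below addrK.
- by rewrite !vertex_swap_apart.
Qed.

Lemma kind_along i : kind_of (frz (mid i) (mid (i + 1))) = Along (pos i).
Proof. by rewrite kind_of_frz ?arrow_mid_mid // /kind_arrow !mid_row eqxx. Qed.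

Lemma kind_to_below i : kind_of (frz (mid i) (below i)) = Into (pos i).
Proof.
by rewrite kind_of_frz ?arrow_mid_below // /kind_arrow mid_row below_row eqxx row_neq.
Qed.

Lemma kind_to_above i : kind_of (frz (mid i) (above (i - 1))) = Into (pos i).
Proof.
by rewrite kind_of_frz ?arrow_mid_above // /kind_arrow mid_row above_row eqxx row_neq.
Qed.

Lemma kind_from_below i : kind_of (frz (below i) (mid (i - 1))) = From (pos (i - 1)).
Proof.
by rewrite kind_of_frz ?arrow_below_mid // /kind_arrow mid_row below_row eqxx row_neq.
Qed.

Lemma kind_from_above i : kind_of (frz (above i) (mid i)) = From (pos i).
Proof.
by rewrite kind_of_frz ?arrow_above_mid // /kind_arrow mid_row above_row eqxx row_neq.
Qed.

Lemma kind_apart (e : frozen n m) :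
  (val e).1.1 != j :> nat -> (val e).2.1 != j :> nat -> kind_of (inr e) = Apart.
Proof. by rewrite /= /kind_arrow => /negPf-> /negPf->. Qed.

Lemma kind_mid i : kind_of (inl (mid i)) = Row (pos i).
Proof. by rewrite /= /kind_mut mid_row eqxx. Qed.

Lemma kind_of_swap v : kind_of (vertex_swap v) = kind_swap n (kind_of v).
Proof.
case: v => [a|e].
  rewrite /vertex_swap; case: eqP => [->|/eqP a2].
    by rewrite !kind_mid pos_last pos_last2 /= eqxx.
  case: eqP => [->|/eqP a1].
    by rewrite !kind_mid pos_last pos_last2 /= eqxx gtn_eqF.
  rewrite /= /kind_mut; case: ifP => [aj|_]; last by do !case: ifP => _.
  move: a2 a1; rewrite !mid_eq aj /= -!(inj_eq pos_inj) pos_last pos_last2.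
  by rewrite !eqSS => /negPf-> /negPf->.
case: (frozenP e) => [i|i|i|i|i|e' h h'].
- by rewrite vertex_swap_along kind_along.
- by rewrite vertex_swap_to_below kind_from_above kind_to_below pos_pred.
- by rewrite vertex_swap_to_above kind_from_below kind_to_above pos_pred.
- by rewrite vertex_swap_from_below kind_from_below kind_to_above /= -pos_succ subrK.
- by rewrite vertex_swap_from_above kind_from_above kind_to_below /= -pos_succ.
- by rewrite vertex_swap_apart // kind_apart.
Qed.

Lemma outer_matrix_skew u v : outer_matrix u v = - outer_matrix v u.
Proof. by rewrite /outer_matrix orbC; case: ifP; rewrite ?oppr0 // /enriched_quiver opprB. Qed.

Lemma outer_frz a (b b' : mut) : arrow b b' -> a.1 != j :> nat ->
  outer_matrix (inl a) (frz b b') = (a == b')%:Z - (a == b)%:Z.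
Proof. by move=> h /negPf aj; rewrite (frzE h) /outer_matrix /= aj. Qed.

Lemma mid_neq a i : a.1 != j :> nat -> (a == mid i) = false.
Proof. by rewrite mid_eq => /negPf->. Qed.

(** The two frozen vertices of kind [From i] belong to arrows that start at the
   two outer mutable vertices of kind [Along i]. *)
Lemma defect_from a i : a.1 != j :> nat ->
  (swap_defect n (kind_mut a) (From (pos i)))%:Z
    = (a == below (i + 1))%:Z + (a == above i)%:Z.
Proof.
move=> /negPf aj; rewrite /kind_mut aj below_eq above_eq.
case: eqP => [->|_] /=; first by rewrite row_neq addr0 (inj_eq pos_inj) eq_sym subr_eq eq_sym.
by case: eqP => _ //=; rewrite add0r (inj_eq pos_inj) eq_sym.
Qed.

Lemma defect_into a i : a.1 != j :> nat ->
  (swap_defect n (Into (pos i)) (kind_mut a))%:Z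
    = (a == below i)%:Z + (a == above (i - 1))%:Z.
Proof.
move=> aj; rewrite -{2}(subrK 1 i) -(defect_from _ aj) /kind_mut (negPf aj).
by do ?[case: ifP => _]; rewrite //= pos_eq_next (inj_eq pos_inj) -subr_eq.
Qed.

Lemma outer_swap_frozen a (e : frozen n m) (u := inl a : vertex) (v := inr e : vertex) :
  outer_matrix (vertex_swap u) (vertex_swap v) = outer_matrix u v
    + (swap_defect n (kind_of u) (kind_of v))%:Z
    - (swap_defect n (kind_of v) (kind_of u))%:Z.
Proof.
rewrite /u /v => {u v}; case: (eqVneq (a.1 : nat) j) => aj.
  have arow : on_row (inl a) by rewrite /on_row aj.
  have arow' : on_row (vertex_swap (inl a)).
    by rewrite /vertex_swap; do ?[case: ifP => _]; rewrite ?/on_row ?mid_row ?aj.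
  rewrite /outer_matrix arow arow' /= /kind_mut aj eqxx add0r.
  by case: (kind_arrow _ _).
have -> : vertex_swap (inl a) = inl a by rewrite /vertex_swap !mid_neq.
have into i : swap_defect n (kind_mut a) (Into (pos i)) = false.
  by rewrite /kind_mut; do !case: ifP => _.
have from i : swap_defect n (From (pos i)) (kind_mut a) = false.
  by rewrite /kind_mut; do !case: ifP => _.
have along i : (swap_defect n (kind_mut a) (Along (pos i)) = false)
    * (swap_defect n (Along (pos i)) (kind_mut a) = false).
  by split; rewrite /kind_mut (negPf aj); do !case: ifP => _.
have apart : (swap_defect n (kind_mut a) Apart = false)
    * (swap_defect n Apart (kind_mut a) = false).
  by split; rewrite /kind_mut (negPf aj); do !case: ifP => _.
have kE : kind_of (inl a) = kind_mut a by [].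
have zero : (nat_of_bool false)%:Z = 0 by [].
case: (frozenP e) => [i|i|i|i|i|e' h h'].
- by rewrite vertex_swap_along kind_along kE !along zero addr0 subr0.
- rewrite vertex_swap_to_below kind_to_below kE into zero defect_into //.
  rewrite !outer_frz ?arrow_above_mid ?arrow_mid_below // !mid_neq // ?zero.
  ring.
- rewrite vertex_swap_to_above kind_to_above kE into zero defect_into //.
  rewrite !outer_frz ?arrow_below_mid ?arrow_mid_above // !mid_neq // ?zero.
  ring.
- rewrite vertex_swap_from_below kind_from_below kE from zero defect_from //.
  rewrite !outer_frz ?arrow_below_mid ?arrow_mid_above // !mid_neq // ?zero.
  rewrite subrK; ring.
- rewrite vertex_swap_from_above kind_from_above kE from zero defect_from //.
  rewrite !outer_frz ?arrow_above_mid ?arrow_mid_below // !mid_neq // ?zero.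
  ring.
- by rewrite vertex_swap_apart // kind_apart // kE !apart zero addr0 subr0.
Qed.

(** Each frozen vertex that is moved changes its neighbour outside the row, and
   [swap_defect] records this change. *)
Lemma outer_swap u v : ~~ (is_frozen u && is_frozen v) ->
  outer_matrix (vertex_swap u) (vertex_swap v) = outer_matrix u v
    + (swap_defect n (kind_of u) (kind_of v))%:Z
    - (swap_defect n (kind_of v) (kind_of u))%:Z.
Proof.
case: u v => [a|e] [c|e'] // _; first last.
- rewrite outer_matrix_skew outer_swap_frozen (outer_matrix_skew (inr e)).
  rewrite !opprD opprK; ring.
- exact: outer_swap_frozen.
have defect0 b b' : swap_defect n (kind_mut b) (kind_mut b') = false.
  by rewrite /kind_mut; do !case: ifP => _.
have kE b : kind_of (inl b) = kind_mut b by [].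
rewrite !kE !defect0 [(nat_of_bool false)%:Z]/(0 : int) addr0 subr0.
have fixed b : on_row (inl b) = false -> vertex_swap (inl b) = inl b.
  by move=> /= /negbT bj; rewrite /vertex_swap !mid_neq.
have row b : on_row (inl b) -> on_row (vertex_swap (inl b)).
  by move=> h; rewrite /vertex_swap; do ?[case: ifP => _] => //; rewrite /on_row mid_row.
rewrite /outer_matrix; case ha: (on_row (inl a)); first by rewrite row.
case hc: (on_row (inl c)); first by rewrite (row c) ?orbT.
by rewrite !fixed // ha hc.
Qed.

Lemma kind_frozen_of v : kind_frozen (kind_of v) -> is_frozen v.
Proof. by case: v => [a|//]; rewrite /= /kind_mut; do !case: ifP => _. Qed.

(** The changes made by the mutations at the leaves and by the transpositions
   cancel. *)
Lemma exch_swap s u v :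
  kind_form s (kind_mutate (kind_mutate (mutated_matrix n d.+1) (Row d.+1)) (Row d.+2)) ->
  ~~ (is_frozen u && is_frozen v) ->
  exch (relabel vertex_swap s) u v
    = outer_matrix u v + mutated_matrix n d.+1 (kind_of u) (kind_of v).
Proof.
move=> sB fr; rewrite /= sB outer_swap // !kind_of_swap.
rewrite -[in RHS](@kind_mutate_last_two n _ d.+1 erefl) ?kind_of_position //.
  ring.
by apply: contra fr => /andP[/kind_frozen_of-> /kind_frozen_of->].
Qed.

End Grid.

(** * Variables along the sequence of mutations *)

Section RowVariables.

Variables (F : fieldType) (n : nat) (x a b c : nat -> F).

(** The new variable at the position h of the row after the mutations at
   0, ..., h.  At h > 0 the arrows into h come from n - 1, [Along h] and all
   [Into i] with i <= h; those out of h go to h - 1, h + 1 and [From h]. *)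
Fixpoint row_var (h : nat) : F :=
  if h is h'.+1 then
    (x n.-1 * a h * \prod_(0 <= i < h.+1) b i + row_var h' * x h.+1 * c h) / x h
  else (x n.-1 * a 0 * b 0 + x 1 * a n.-1 * c 0) / x 0.

Lemma row_varS h : row_var h.+1 =
  (x n.-1 * a h.+1 * \prod_(0 <= i < h.+2) b i + row_var h * x h.+2 * c h.+1) / x h.+1.
Proof. by []. Qed.

(** This and [last_var] are the new variables at the leaves n - 2 and n - 1, both
   adjacent to n - 3 but not to each other. *)
Definition penultimate_var : F :=
  (a n.-2 * \prod_(0 <= i < n.-1) b i + row_var n.-2.-1 * c n.-2) / x n.-2.

Definition last_var : F :=
  (row_var n.-2.-1 * b n.-1 + a n.-2 * (\prod_(0 <= i < n.-2) c i) * c n.-1) / x n.-1.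

End RowVariables.

Section Cluster.

Variables (d m j : nat) (k : 'Z_d.+3).
Hypothesis jm : (0 < j < m)%N.

Local Notation n := d.+3.
Local Notation vertex := (vertex n m).
Local Notation mid := (@mid n m j).
Local Notation kind_of := (@kind_of d m j k).
Local Notation F := (ratfield n m).
Implicit Types (z : vertex -> F) (s : seed n m) (l : seq kind) (p : kind).

Definition kind_prod z l : F := \prod_(u : vertex | kind_of u \in l) z u.

Lemma kind_prod_seq z l : uniq l -> kind_prod z l = \prod_(p <- l) kind_prod z [:: p].
Proof.
elim: l => [|p l IH] /=; first by rewrite big_nil /kind_prod big_pred0_eq.
case/andP=> pl ul; rewrite big_cons -IH // /kind_prod (bigID (fun u => kind_of u == p)) /=.
congr (_ * _); apply: eq_bigl => u; rewrite !inE; case: eqP => [->|_] /=;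
  by rewrite ?andbT ?andbF ?(negPf pl).
Qed.

Definition at_pos h := mid (k + h%:R).

Lemma kind_of_at v h : (h < n)%N -> (kind_of v == Row h) = (v == inl (at_pos h)).
Proof. by move=> hn; rewrite -(kind_of_row k jm) pos_shift. Qed.

Lemma kind_prod_row z h : (h < n)%N -> kind_prod z [:: Row h] = z (inl (at_pos h)).
Proof.
by move=> hn; rewrite /kind_prod (big_pred1 (inl (at_pos h))) // => u; rewrite inE kind_of_at.
Qed.

Lemma kind_prod_eq z z' l :
  (forall v, kind_of v \in l -> z v = z' v) -> kind_prod z l = kind_prod z' l.
Proof. exact: eq_bigr. Qed.

(** Lists of kinds rather than predicates, so that the two monomials come out as
   products with one factor for each kind. *)
Lemma exch_sum_kind s B h (lin lout : seq kind) : (h < n)%N ->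
  kind_form j k s B -> uniq lin -> uniq lout ->
  (forall p, ~~ ((p \in lin) && (p \in lout))) ->
  (forall p, (position p < n)%N -> B p (Row h) = (p \in lin)%:Z - (p \in lout)%:Z) ->
  exch_sum (exch s) (cluster s) (inl (at_pos h)) =
    \prod_(p <- lin) kind_prod (cluster s) [:: p]
    + \prod_(p <- lout) kind_prod (cluster s) [:: p].
Proof.
move=> hn sB ulin ulout dis col.
have colE u : exch s u (inl (at_pos h)) = (kind_of u \in lin)%:Z - (kind_of u \in lout)%:Z.
  have row : @on_row d m j (inl (at_pos h)) by rewrite /on_row mid_row.
  rewrite sB /outer_matrix row orbT add0r.
  by rewrite kind_mid // pos_shift // col // kind_of_position.
rewrite -!kind_prod_seq //; congr (_ + _); apply: eq_big => u; rewrite colE;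
  by have := dis (kind_of u); case: (kind_of u \in lin); case: (kind_of u \in lout).
Qed.

Definition row_seq (t : nat) : seq (mut n m) := [seq at_pos h | h <- iota 0 t].

Lemma row_seqS t : row_seq t.+1 = rcons (row_seq t) (at_pos t).
Proof. by rewrite /row_seq -cats1 -[X in iota 0 X]addn1 iotaD map_cat. Qed.

Lemma cluster_mutate s e v : v != inl e -> cluster (mutate e s) v = cluster s v.
Proof. by move=> /negPf /= ->. Qed.

Lemma mutations_rcons (r : seq (mut n m)) e s :
  mutations (rcons r e) s = mutate e (mutations r s).
Proof. by rewrite /mutations -cats1 foldl_cat. Qed.

Lemma mem_Intos p t :
  (p \in [seq Into i | i <- iota 0 t]) = if p is Into i then (i < t)%N else false.
Proof.
case: p => [i|i|i|i|]; try by apply/mapP => -[].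
by rewrite mem_map ?mem_iota // => ? ? [].
Qed.

Lemma mem_Froms p t :
  (p \in [seq From i | i <- iota 0 t]) = if p is From i then (i < t)%N else false.
Proof.
case: p => [i|i|i|i|]; try by apply/mapP => -[].
by rewrite mem_map ?mem_iota // => ? ? [].
Qed.

Lemma uniq_Intos t : uniq [seq Into i | i <- iota 0 t].
Proof. by rewrite map_inj_uniq ?iota_uniq // => ? ? []. Qed.

Lemma uniq_Froms t : uniq [seq From i | i <- iota 0 t].
Proof. by rewrite map_inj_uniq ?iota_uniq // => ? ? []. Qed.

Lemma prod_Intos z z' t :
  (forall p, (forall h, p != Row h) -> kind_prod z [:: p] = kind_prod z' [:: p]) ->
  \prod_(p <- [seq Into i | i <- iota 0 t]) kind_prod z [:: p]
    = \prod_(0 <= i < t) kind_prod z' [:: Into i].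
Proof. by move=> e; rewrite big_map /index_iota subn0; apply: eq_bigr => i _; apply: e. Qed.

Lemma prod_Froms z z' t :
  (forall p, (forall h, p != Row h) -> kind_prod z [:: p] = kind_prod z' [:: p]) ->
  \prod_(p <- [seq From i | i <- iota 0 t]) kind_prod z [:: p]
    = \prod_(0 <= i < t) kind_prod z' [:: From i].
Proof. by move=> e; rewrite big_map /index_iota subn0; apply: eq_bigr => i _; apply: e. Qed.

Variable z : vertex -> F.

Local Notation x := (fun h => z (inl (at_pos h))).
Local Notation a := (fun h => kind_prod z [:: Along h]).
Local Notation b := (fun h => kind_prod z [:: Into h]).
Local Notation c := (fun h => kind_prod z [:: From h]).
Local Notation y := (row_var n x a b c).

(** The variables after the mutations at the positions 0, ..., t - 1. *)
Definition row_cluster (t : nat) (v : vertex) : F :=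
  if kind_of v is Row p then if (p < t)%N then y p else z v else z v.

Local Notation W t := (mutations (row_seq t) (Seed (@enriched_quiver n m) z)).

Lemma row_cluster_at t h : (h < n)%N ->
  row_cluster t (inl (at_pos h)) = if (h < t)%N then y h else z (inl (at_pos h)).
Proof. by move=> hn; rewrite /row_cluster kind_mid // pos_shift. Qed.

Lemma kind_prod_outer s t p : cluster s =1 row_cluster t ->
  (forall h, p != Row h) -> kind_prod (cluster s) [:: p] = kind_prod z [:: p].
Proof.
move=> sz pr; apply: kind_prod_eq => v; rewrite inE sz /row_cluster => /eqP e.
by case: (kind_of v) e (pr) => // h <- /(_ h); rewrite eqxx.
Qed.

Lemma row_cluster_step s t : (t < n)%N -> cluster s =1 row_cluster t ->
  y t = exch_sum (exch s) (cluster s) (inl (at_pos t)) / z (inl (at_pos t)) ->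
  cluster (mutate (at_pos t) s) =1 row_cluster t.+1.
Proof.
move=> tn sz yE v.
change (mutated (exch s) (cluster s) (inl (at_pos t)) v = row_cluster t.+1 v).
rewrite /mutated; case: eqP => [->|/eqP ne].
  by rewrite mulrC row_cluster_at // ltnSn yE sz row_cluster_at // ltnn.
rewrite sz /row_cluster; case E: (kind_of v) => [p|p|p|p|] //.
rewrite ltnS [(p <= t)%N]leq_eqVlt; case: (eqVneq p t) => [ept|_] //.
by move: ne; rewrite -kind_of_at // E ept eqxx.
Qed.

(** Each mutation reads its two monomials off a column of the matrix of kinds,
   which the preceding mutations have made explicit; [z] is arbitrary, as the
   statement is needed for the initial variables and for the images. *)
Lemma first_half t : (0 < t)%N -> (t <= d.+1)%N ->
  kind_form j k (W t) (mutated_matrix n t) /\ cluster (W t) =1 row_cluster t.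
Proof.
elim: t => // -[_ _ _|t IH _ td].
  rewrite row_seqS mutations_rcons [mutations (row_seq 0) _]/=.
  have form0 := kind_form_start k jm z.
  split.
    apply: (@kind_form_eq _ _ _ _ _ (kind_mutate (start_matrix n) (Row 0))).
      have := kind_form_mutate jm (k + 0%:R) form0.
      by rewrite pos_shift.
    by move=> p q pn qn; apply: kind_mutate_start.
  have z0 : cluster (Seed (@enriched_quiver n m) z) =1 row_cluster 0.
    by move=> v; rewrite /row_cluster; case: (kind_of v).
  apply: row_cluster_step => //.
  rewrite (@exch_sum_kind _ _ _ [:: Row n.-1; Along 0; Into 0]
    [:: Row 1; Along n.-1; From 0] _ form0) //=; first last.
  - move=> p pn; rewrite (start_column _ pn) // !inE /first_in /first_out.
    by case: p pn => [i|i|i|i|] _; rewrite !kind_eqE /= ?orbF ?eqSS.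
  - case=> [i|i|i|i|]; rewrite !inE !kind_eqE /= ?orbF ?andbF //; lia.
  by rewrite !big_cons !big_nil !kind_prod_row //= !mulr1 !mulrA.
have [//||formt zt] := IH; first exact: ltnW.
rewrite row_seqS mutations_rcons; split.
  apply: (@kind_form_eq _ _ _ _ _ (kind_mutate (mutated_matrix n t.+1) (Row t.+1))).
    have := kind_form_mutate jm (k + t.+1%:R) formt.
    by rewrite pos_shift //; lia.
  by move=> p q pn qn; apply: kind_mutate_later.
apply: row_cluster_step => //; first by lia.
rewrite (@exch_sum_kind _ _ _ ([:: Row n.-1; Along t.+1] ++ [seq Into i | i <- iota 0 t.+2])
    [:: Row t; Row t.+2; From t.+1] _ formt) //; first last.
- move=> p pn; rewrite (later_column _ _ _ pn) // mem_cat mem_Intos !inE !kind_eqE.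
  by rewrite /later_in /later_out; case: p pn => [i|i|i|i|] _; rewrite /= ?orbF ?eqSS.
- case=> [i|i|i|i|]; rewrite mem_cat mem_Intos !inE !kind_eqE /= ?andbF //; lia.
- by rewrite /= !inE !kind_eqE /=; lia.
- rewrite cat_uniq uniq_Intos andbT; apply/andP; split=> //.
  by apply/hasPn => p; rewrite mem_Intos !inE !kind_eqE; case: p.
- by lia.
rewrite big_cat (prod_Intos _ (fun p => @kind_prod_outer _ _ p zt)).
rewrite [y _]row_varS; set P := \prod_(0 <= i < _) _; rewrite !big_cons !big_nil /= !mulr1.
rewrite !kind_prod_row ?(kind_prod_outer zt) ?zt ?row_cluster_at //; try lia.
rewrite ltnSn [(d.+2 < _)%N]ltnNge [(t.+2 < _)%N]ltnNge leqnSn.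
rewrite (_ : (t.+1 <= d.+2)%N) /=; last by lia.
by rewrite !mulrA.
Qed.

(** The same for the two mutations at the leaves. *)
Lemma second_half (s := mutate (at_pos d.+2) (mutate (at_pos d.+1) (W d.+1))) :
  kind_form j k s (kind_mutate (kind_mutate (mutated_matrix n d.+1) (Row d.+1)) (Row d.+2))
  /\ forall v, cluster s v =
       if kind_of v is Row p then
         if (p < d.+1)%N then y p
         else if p == d.+1 then penultimate_var n x a b c else last_var n x a b c
       else z v.
Proof.
have dn : (d < n)%N by lia.
have [//|//|form z1] := @first_half d.+1.
have form1 := kind_form_mutate jm (k + d.+1%:R) form.
have form2 := kind_form_mutate jm (k + d.+2%:R) form1.
move: form1 form2; rewrite !pos_shift // -/(at_pos _) => form1 form2.
split; first exact: form2.
have pen : cluster (mutate (at_pos d.+1) (W d.+1)) (inl (at_pos d.+1)) = penultimate_var n x a b c.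
  change (mutated (exch (W d.+1)) (cluster (W d.+1)) (inl (at_pos d.+1)) (inl (at_pos d.+1))
    = penultimate_var n x a b c).
  rewrite /mutated eqxx mulrC.
  rewrite (@exch_sum_kind _ _ _ (Along d.+1 :: [seq Into i | i <- iota 0 d.+2])
    [:: Row d; From d.+1] _ form) //; first last.
  - move=> p pn; rewrite (@last_column0 n isT _ erefl _ pn).
    rewrite [p \in Along _ :: _]in_cons mem_Intos !inE !kind_eqE /last_in0 /last_out0.
    by case: p pn => [i|i|i|i|] _; rewrite /= ?orbF.
  - by case=> [i|i|i|i|]; rewrite [_ \in Along _ :: _]in_cons mem_Intos !inE !kind_eqE /= ?andbF.
  - rewrite cons_uniq uniq_Intos andbT mem_Intos //.
  rewrite big_cons (prod_Intos _ (fun p => @kind_prod_outer _ _ p z1)) /penultimate_var.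
  set P := \prod_(0 <= i < _) _.
  rewrite !big_cons !big_nil !mulr1.
  rewrite !kind_prod_row ?(kind_prod_outer z1) // !z1 !row_cluster_at //.
  by rewrite ltnSn ltnn.
have z2 v : v != inl (at_pos d.+1) ->
  cluster (mutate (at_pos d.+1) (W d.+1)) v = row_cluster d.+1 v.
  by move=> vn; rewrite cluster_mutate.
have z2_at h : (h < n)%N -> h != d.+1 ->
  cluster (mutate (at_pos d.+1) (W d.+1)) (inl (at_pos h))
    = if (h < d.+1)%N then y h else z (inl (at_pos h)).
  move=> hn hd; rewrite z2 ?row_cluster_at //.
  by rewrite -kind_of_at // kind_mid // pos_shift // kind_eqE.
have z2_outer p : (forall h, p != Row h) ->
    kind_prod (cluster (mutate (at_pos d.+1) (W d.+1))) [:: p] = kind_prod z [:: p].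
  move=> pr; rewrite -(kind_prod_outer z1 pr); apply: kind_prod_eq => v.
  rewrite inE z1 => /eqP vp; rewrite z2 // -kind_of_at // vp; exact: pr.
have last : cluster (mutate (at_pos d.+2) (mutate (at_pos d.+1) (W d.+1))) (inl (at_pos d.+2))
    = last_var n x a b c.
  set s1 := mutate (at_pos d.+1) _ in form1 form2 z2 z2_at z2_outer *.
  clearbody s1.
  change (mutated (exch s1) (cluster s1) (inl (at_pos d.+2)) (inl (at_pos d.+2))
    = last_var n x a b c).
  rewrite /mutated eqxx mulrC.
  rewrite (@exch_sum_kind _ _ _ [:: Row d; Into d.+2]
    ([:: Along d.+1; From d.+2] ++ [seq From i | i <- iota 0 d.+1]) _ form1) //; first last.
  - move=> p pn; rewrite (@last_column1 n isT _ erefl _ pn).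
    rewrite mem_cat mem_Froms !inE !kind_eqE /last_in1 /last_out1.
    by case: p pn => [i|i|i|i|] _; rewrite /= ?orbF // orbC.
  - by case=> [i|i|i|i|]; rewrite mem_cat mem_Froms !inE !kind_eqE /= ?orbF ?andbF //; lia.
  - rewrite cat_uniq uniq_Froms andbT; apply/andP; split=> //.
    by apply/hasPn => p; rewrite mem_Froms !inE !kind_eqE; case: p => //= i; lia.
  rewrite big_cat (prod_Froms _ z2_outer) /last_var.
  set P := \prod_(0 <= i < _) _.
  rewrite !big_cons !big_nil /= !mulr1.
  rewrite !kind_prod_row // !z2_outer //.
  rewrite (z2_at d) ?ltn_eqF // (z2_at d.+2) ?gtn_eqF // ltnSn.
  by rewrite ltnNge leqnSn /= mulrAC.
move=> v; case E: (kind_of v) => [p|p|p|p|].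
- have pn : (p < n)%N by have := @kind_of_position d m j k v; rewrite E.
  have /eqP -> : v == inl (at_pos p) by rewrite -kind_of_at // E.
  have [->|p2] := eqVneq p d.+2; first by rewrite last ltnNge leqnSn /= gtn_eqF.
  have s2 : cluster s (inl (at_pos p))
      = cluster (mutate (at_pos d.+1) (W d.+1)) (inl (at_pos p)).
    by rewrite [LHS]cluster_mutate // -kind_of_at // kind_mid // pos_shift // kind_eqE.
  rewrite s2; have [->|p1] := eqVneq p d.+1; first by rewrite pen ltnn.
  by rewrite z2_at //; case: ifP => //; lia.
all: have ne h : (h < n)%N -> v != inl (at_pos h) by [move=> hn; rewrite -kind_of_at // E].
all: by rewrite /s cluster_mutate ?ne // z2 ?ne // /row_cluster E.
Qed.

End Cluster.

(** * Identities behind the cluster R-matrix *)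

Section Identities.

Variables (F : fieldType) (d : nat) (x a b c : nat -> F).
Local Notation n := d.+3.
Hypothesis x_per : forall i, x (i + n)%N = x i.
Hypothesis a_per : forall i, a (i + n)%N = a i.
Hypothesis b_per : forall i, b (i + n)%N = b i.
Hypothesis c_per : forall i, c (i + n)%N = c i.
Hypothesis x_neq0 : forall i, x i != 0.

Definition edge_weight l := a l / (x l * x l.+1).

Local Notation g := edge_weight.

(** The factor by which the cluster R-matrix multiplies x_i. *)
Definition R_ratio i : F := \sum_(i <= l < i + n)
  g l * (\prod_(l.+1 <= h < i + n) c h) * (\prod_(i.+1 <= h < l.+1) b h).

Local Notation r := R_ratio.
Local Notation P := (\prod_(0 <= h < n) b h).
Local Notation Q := (\prod_(0 <= h < n) c h).

Lemma edge_weight_per i : g (i + n)%N = g i.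
Proof. by rewrite /edge_weight a_per x_per -addSn x_per. Qed.

Lemma prod_period (f : nat -> F) i : (forall h, f (h + n)%N = f h) ->
  \prod_(i <= h < i + n) f h = \prod_(0 <= h < n) f h.
Proof.
move=> fper; elim: i => [|i IH]; first by rewrite add0n.
rewrite -IH addSn big_nat_recr /=; last by lia.
by rewrite [RHS]big_ltn ?fper 1?mulrC //; lia.
Qed.

Lemma R_ratio_per i : r (i + n)%N = r i.
Proof.
rewrite /R_ratio big_addn addnK; apply: eq_bigr => l _.
rewrite edge_weight_per -!addSn !big_addn !addnK.
by congr (_ * _ * _); apply: eq_bigr => h _; rewrite ?b_per ?c_per.
Qed.

(** Multiplied by b_{i+1} and c_i respectively, the sums at i + 1 and i have the
   same terms except for one of each, both proportional to g_i. *)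
Lemma R_ratio_step i : b i.+1 * r i.+1 = c i * r i + g i * (P - Q).
Proof.
have Bi : P = \prod_(i.+1 <= h < i.+1 + n) b h by rewrite prod_period.
have Ci : Q = \prod_(i <= h < i + n) c h by rewrite prod_period.
have lin : (i < i + n)%N by rewrite -{1}[i]addn0 ltn_add2l.
rewrite Bi Ci /R_ratio [\sum_(i <= l < i + n) _]big_ltn // addSn big_nat_recr //=.
rewrite [\prod_(i.+1 <= h < i.+1) _]big_geq // mulr1.
rewrite [\prod_((i + n).+1 <= h < _) _]big_geq // mulr1 edge_weight_per.
rewrite [\prod_(i <= h < i + n) c h]big_ltn // [\prod_(i.+1 <= h < (i + n).+1) b h]big_ltn.
  rewrite !mulrDr; set S := _ * \sum_(_ <= _ < _) _; set T := _ * \sum_(_ <= _ < _) _.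
  suff -> : S = T by ring.
  rewrite /S /T !mulr_sumr; apply: eq_big_nat => l /andP[il li].
  rewrite big_nat_recr ?c_per //= [\prod_(i.+1 <= h < l.+1) _]big_ltn //; ring.
exact: lin.
Qed.

(** The variables of the row divided by their right neighbours: the recurrence
   becomes linear in each step, and its solution is x_{n-1} times a partial sum of
   [R_ratio] at n - 1. *)
Fixpoint partial_ratio h : F :=
  if h is h'.+1 then
    partial_ratio h' * c h' + x n.-1 * g h' * \prod_(0 <= i < h'.+1) b i
  else x n.-1 * g n.-1.

Local Notation Y := partial_ratio.

Lemma row_var_partial h : row_var n x a b c h = x h.+1 * Y h.+1.
Proof.
have x0 : x n = x 0 by rewrite -(x_per 0).
elim: h => [|h IH] /=; last rewrite IH /=.
  rewrite big_nat1 /edge_weight /= x0; field.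
  by rewrite !x_neq0.
rewrite /edge_weight; set p := \prod_(0 <= i < h.+2) _; set q := \prod_(0 <= i < _) _.
field; by rewrite !x_neq0.
Qed.

Lemma partial_ratio_sum h : Y h = x n.-1 * \sum_(n.-1 <= l < n + h)
  g l * (\prod_(l.+1 <= i < n + h) c i) * (\prod_(n <= i < l.+1) b i).
Proof.
elim: h => [|h IH].
  by rewrite addn0 big_nat1 !big_geq //= !mulr1.
rewrite /= IH addnS [in RHS]big_nat_recr /=; last by lia.
rewrite mulrDr; congr (_ + _).
  rewrite -mulrA mulr_suml; congr (_ * _); apply: eq_big_nat => l /andP[_ ln].
  by rewrite [in RHS]big_nat_recr /= ?[(n + h)%N]addnC ?c_per; [ring | lia].
rewrite [\prod_((n + h).+1 <= i < _) _]big_geq // mulr1 addnC edge_weight_per mulrA.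
congr (_ * _).
rewrite -[RHS]/(\prod_(0 + n <= i < h.+1 + n) b i) big_addn addnK.
by apply: eq_bigr => i _; rewrite b_per.
Qed.

Lemma penultimate_R : penultimate_var n x a b c = x n.-1 * r n.-1.
Proof.
have -> : penultimate_var n x a b c = Y n.-1.
  rewrite /penultimate_var row_var_partial /= /edge_weight.
  set p := \prod_(0 <= i < _) b i; field; by rewrite !x_neq0.
by rewrite partial_ratio_sum /R_ratio addnC.
Qed.

Lemma last_R : last_var n x a b c = x n.-2 * r n.-2.
Proof.
rewrite /last_var row_var_partial.
rewrite /R_ratio [\sum_(_ <= _ < _) _]big_ltn; last by lia.
rewrite [\prod_(n.-2.+1 <= h < n.-2.+1) _]big_geq // mulr1.
have -> : \prod_(n.-2.+1 <= h < n.-2 + n) c h = (\prod_(0 <= i < n.-2) c i) * c n.-1.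
  rewrite big_ltn; last by lia.
  rewrite mulrC -[X in X * _]/(\prod_(0 + n <= i < n.-2 + n) c i) big_addn addnK.
  by congr (_ * _); apply: eq_bigr => i _; rewrite c_per.
have -> : \sum_(n.-2.+1 <= l < n.-2 + n) g l * \prod_(l.+1 <= h < n.-2 + n) c h
     * \prod_(n.-2.+1 <= h < l.+1) b h = b n.-1 * (Y n.-2 / x n.-1).
  rewrite partial_ratio_sum mulrAC mulfV ?x_neq0 // mul1r mulr_sumr addnC.
  apply: eq_big_nat => l /andP[ln _].
  rewrite [\prod_(n.-2.+1 <= h < l.+1) _]big_ltn //; ring.
rewrite /edge_weight [n.-2.-1.+1]/(n.-2); set p := \prod_(0 <= i < _) _; set y := Y _.
rewrite /=; field; by rewrite !x_neq0.
Qed.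

Section Image.

Variables x' b' c' : nat -> F.
Hypothesis x'E : forall i, x' i = x i * r i.
Hypothesis x'_neq0 : forall i, x' i != 0.
Hypothesis b'E : forall i, b' i.+1 = c i.
Hypothesis b'0 : b' 0%N = c n.-1.
Hypothesis c'E : forall i, c' i = b i.+1.

(** Both sides satisfy the same recurrence in h, by [R_ratio_step]. *)
Lemma partial_ratio_discrepancy h :
  x n.-1 * (\prod_(0 <= i < h.+1) b i * r h - \prod_(0 <= i < h) c i * c n.-1 * r n.-1)
    = Y h * (P - Q).
Proof.
elim: h => [|h IH].
  rewrite big_nat1 big_geq // mul1r.
  have := R_ratio_step n.-1; rewrite /= -[b n]/(b (0 + n)%N) b_per.
  rewrite -[r n]/(r (0 + n)%N) R_ratio_per => ->; ring.
rewrite big_nat_recr //= -mulrA R_ratio_step mulrDl.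
rewrite [Y h * c h * _]mulrAC -IH [\prod_(0 <= i < h.+1) c i]big_nat_recr //=.
set p := \prod_(0 <= i < h.+1) b i; set q := \prod_(0 <= i < h) c i; ring.
Qed.

(** The exchange relation for the image variables, divided by those of the row. *)
Lemma partial_ratio_exchange h : Y h.+1 * r h =
  x n.-1 * r n.-1 * g h * (\prod_(0 <= i < h) c i * c n.-1) + Y h * (b h.+1 * r h.+1).
Proof.
rewrite R_ratio_step mulrDr [Y h * (g h * _)]mulrCA -partial_ratio_discrepancy /=.
set p := \prod_(0 <= i < h.+1) b i; set q := \prod_(0 <= i < h) c i; ring.
Qed.

(** By [partial_ratio_exchange], the variables of the row obey the recurrence of
   the images, in which b and c are exchanged with a shift. *)
Lemma row_var_invariant h : row_var n x' a b' c' h = row_var n x a b c h.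
Proof.
have r_neq0 i : r i != 0.
  by have := x'_neq0 i; rewrite x'E mulf_eq0 negb_or => /andP[].
have x0 : x n = x 0 by rewrite -(x_per 0).
elim: h => [|h IH].
  rewrite row_var_partial; apply: (mulIf (x'_neq0 0)).
  rewrite /row_var divfK //; have := partial_ratio_exchange 0.
  rewrite !x'E b'0 c'E big_geq // mul1r => E.
  have -> : x 1%N * Y 1%N * (x 0%N * r 0%N) = x 1%N * x 0%N * (Y 1%N * r 0%N) by rewrite mulrACA.
  rewrite E /= /edge_weight x0; field; by rewrite !x_neq0.
apply: (mulIf (x'_neq0 h.+1)); rewrite row_varS divfK // IH.
have -> : \prod_(0 <= i < h.+2) b' i = \prod_(0 <= i < h.+1) c i * c n.-1.
  rewrite big_nat_recl // b'0 mulrC; congr (_ * _).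
  by apply: eq_bigr => i _; rewrite b'E.
rewrite !row_var_partial !x'E c'E.
rewrite [RHS]mulrACA partial_ratio_exchange /edge_weight.
set q := \prod_(0 <= i < h.+1) c i; set y := Y h.+1.
field; by rewrite !x_neq0.
Qed.

End Image.

End Identities.

(** * The seed of the images *)

Lemma row_var_ext (F : fieldType) n (x a b c x' a' b' c' : nat -> F) :
  (forall i, (i < n)%N -> x i = x' i) -> (forall i, (i < n)%N -> a i = a' i) ->
  (forall i, (i < n)%N -> b i = b' i) -> (forall i, (i < n)%N -> c i = c' i) ->
  forall h, (h.+1 < n)%N -> row_var n x a b c h = row_var n x' a' b' c' h.
Proof.
move=> ex ea eb ec; elim=> [|h IH] hn /=.
  by rewrite !ex ?ea ?eb ?ec //; lia.
rewrite IH ?(ltnW hn) // !ex ?ea ?ec //; try lia.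
congr ((_ * _ + _) / _); apply: eq_big_nat => i /andP[_ ih].
by rewrite eb //; lia.
Qed.

Lemma R_ratio_ext (F : fieldType) d (x a b c x' a' b' c' : nat -> F) h h' :
  (forall e, x (e + h)%N = x' (e + h')%N) -> (forall e, a (e + h)%N = a' (e + h')%N) ->
  (forall e, b (e + h)%N = b' (e + h')%N) -> (forall e, c (e + h)%N = c' (e + h')%N) ->
  R_ratio d x a b c h = R_ratio d x' a' b' c' h'.
Proof.
have shift (G : nat -> F) i p q :
    \prod_(p + i <= l < q + i) G l = \prod_(p <= l < q) G (l + i)%N.
  by rewrite big_addn addnK.
have ratioE (y e f g : nat -> F) i : R_ratio d y e f g i =
    \sum_(0 <= l < d.+3) edge_weight y e (l + i) *
      (\prod_(l.+1 <= q < d.+3) g (q + i)%N) * (\prod_(1 <= q < l.+1) f (q + i)%N).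
  rewrite /R_ratio [(i + d.+3)%N]addnC -[X in \sum_(X <= _ < _) _]add0n big_addn addnK.
  apply: eq_bigr => l _; congr (_ * _ * _); first by rewrite -addSn shift.
  by rewrite -addSn -[i.+1]add1n shift.
move=> ex ea eb ec; rewrite !ratioE; apply: eq_bigr => l _.
congr (_ * _ * _); first by rewrite /edge_weight -!addSn !ex ea.
- by apply: eq_bigr => q _; rewrite ec.
- by apply: eq_bigr => q _; rewrite eb.
Qed.

(** The products over all but two vertices of the row in the definition of the
   cluster R-matrix are the full product divided by two variables. *)
Lemma cancel_total_product (F : fieldType) (p u v e1 e2 e3 q q' : F) : p != 0 ->
  p^-1 * (e1 * (p / u / v) * e2 * e3 * q * q') = e1 * e2 * e3 / (u * v) * q * q'.
Proof.
move=> p0; rewrite invfM.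
have -> : e1 * (p / u / v) * e2 * e3 * q * q' = p * (e1 * e2 * e3 / u / v * q * q').
  ring.
by rewrite mulKf // !mulrA.
Qed.

Lemma kind_swapK n u : (position u < n)%N -> kind_swap n (kind_swap n u) = u.
Proof.
case: u => [i|i|i|i|]; rewrite /kind_swap /position /cyc_prev /cyc_next //= => ?;
  congr (_ _); decide_atoms.
Qed.

Section Target.

Variables (d m j : nat).
Hypothesis jm : (0 < j < m)%N.

Local Notation n := d.+3.
Local Notation vertex := (vertex n m).
Local Notation F := (ratfield n m).
Local Notation mid := (@mid n m j).
Local Notation below := (@below n m j).
Local Notation above := (@above n m j).
Implicit Types (i k : 'Z_n) (v : vertex).

Definition x_at i : F := var (inl (mid i)).
Definition along_at i : F :=
  var (inl (below (i + 1))) * var (inl (above i)) * var (frz (mid i) (mid (i + 1))).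
Definition into_at i : F :=
  var (frz (mid i) (below i)) * var (frz (mid i) (above (i - 1))).
Definition from_at i : F :=
  var (frz (above i) (mid i)) * var (frz (below (i + 1)) (mid i)).

Lemma Zp_periodic (f : 'Z_n -> F) k h : f (k + (h + n)%:R) = f (k + h%:R).
Proof. by rewrite natrD (pchar_Zp (p := n)) // addr0. Qed.

Lemma var_neq0 v : var v != 0.
Proof.
by apply: evaluates_neq0 (var_evaluates (fun=> 1) v) _; rewrite oner_neq0.
Qed.

Lemma x_at_neq0 i : x_at i != 0.
Proof. exact: var_neq0. Qed.

Lemma Zp_natS h : (h.+1)%:R = h%:R + 1 :> 'Z_n.
Proof. exact: mulrSr. Qed.

Lemma R_image_ratio i : R_image m j i = x_at i *
  R_ratio d (fun h => x_at h%:R) (fun h => along_at h%:R) (fun h => into_at h%:R)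
    (fun h => from_at h%:R) i.
Proof.
have PiE (p : 'Z_n) (P : pred 'Z_n) : P p ->
    \prod_(h | P h && (h != p)) x_at h = (\prod_(h | P h) x_at h) / x_at p.
  by move=> Pp; rewrite [in RHS](bigD1 p) //= mulrAC mulfV ?x_at_neq0 ?mul1r.
have Pi0 : \prod_(h : 'Z_n) x_at h != 0 by apply/prodf_neq0 => h _; exact: x_at_neq0.
rewrite /R_image /R_ratio (PiE i predT isT) invf_div -mulrA.
congr (_ * _); rewrite mulr_sumr; apply: eq_bigr => l _.
have ne : (l.+1)%:R != l%:R :> 'Z_n.
  by rewrite Zp_natS -subr_eq0 addrAC subrr add0r oner_neq0.
have fromE h : from_at h%:R =
    var (frz (above h%:R) (mid h%:R)) * var (frz (below h.+1%:R) (mid h%:R)).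
  by rewrite /from_at -Zp_natS.
rewrite (PiE _ (fun h => h != l%:R)) // (PiE _ predT) //.
rewrite [in RHS](eq_bigr _ (fun h _ => fromE h)) /edge_weight /along_at -Zp_natS.
exact: cancel_total_product.
Qed.

Lemma R_image_shift k h : R_image m j (k + h%:R) = x_at (k + h%:R) *
  R_ratio d (fun h => x_at (k + h%:R)) (fun h => along_at (k + h%:R))
    (fun h => into_at (k + h%:R)) (fun h => from_at (k + h%:R)) h.
Proof.
rewrite R_image_ratio; congr (_ * _).
have e l : (l + nat_of_ord (k + h%:R)%R)%N%:R = k + (l + h)%:R :> 'Z_n.
  by rewrite !natrD natr_Zp addrCA.
by apply: R_ratio_ext => l; rewrite e.
Qed.

(** The values of the cluster R-matrix on the variables.  The base point of
   [vertex_swap] concerns the row, so any one serves for the frozen vertices. *)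
Definition R_target v : F :=
  match v with
  | inl a => if a.1 == j :> nat then R_image m j a.2 else var v
  | inr _ => var (vertex_swap j 0 v)
  end.

Lemma R_target_mid i : R_target (inl (mid i)) = R_image m j i.
Proof. by rewrite /R_target mid_row // eqxx. Qed.

Lemma R_target_frz k (b b' : mut n m) : arrow b b' ->
  R_target (frz b b') = var (vertex_swap j k (frz b b')).
Proof. by move=> h; rewrite (frzE h). Qed.

Lemma R_target_outer k v : ~~ on_row j v -> R_target v = var (vertex_swap j k v).
Proof.
case: v => [a|e] //= aj; rewrite (negPf aj) !mid_neq //.
Qed.

Lemma frz_eq (b b' e e' : mut n m) : arrow b b' -> arrow e e' ->
  (frz b b' == frz e e') = (b == e) && (b' == e').
Proof. by move=> h h'; rewrite (frzE h) (frzE h') -xpair_eqE. Qed.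

Lemma inl_frz_eq a (b b' : mut n m) : arrow b b' -> (inl a == frz b b') = false.
Proof. by move=> h; rewrite (frzE h). Qed.

Section Base.

Variable k : 'Z_n.

Local Notation kind_of := (@kind_of d m j k).

Lemma kind_prod_list z p (l : seq vertex) : uniq l ->
  (forall v, (kind_of v == p) = (v \in l)) -> kind_prod j k z [:: p] = \prod_(v <- l) z v.
Proof.
move=> ul e; rewrite big_uniq //; apply: eq_bigl => v.
by rewrite inE e.
Qed.

Lemma kind_prod_along h : (h < n)%N ->
  kind_prod j k (@var n m) [:: Along h] = along_at (k + h%:R).
Proof.
move=> hn; set i := k + h%:R; have ih : h = pos k i by rewrite pos_shift.
rewrite (@kind_prod_list _ _ [:: inl (below (i + 1)); inl (above i);
  frz (mid i) (mid (i + 1))]); first by rewrite !big_cons big_nil mulr1 mulrA.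
  rewrite /= !inE !inl_frz_eq ?arrow_mid_mid // -[_ == inl _]/(below _ == _).
  by rewrite below_neq_above.
move=> v; rewrite ih; apply/eqP/idP => [|].
  case: v => [a|e].
    rewrite !inE -[_ == inl (below _)]/(a == _) -[_ == inl (above _)]/(a == _).
    rewrite below_eq // above_eq // /= /kind_mut.
    case: ifP => // _; case: ifP => [_ [/pos_inj<-]|_]; first by rewrite subrK eqxx.
    by case: ifP => [_ [/pos_inj<-]|_]; first by rewrite eqxx orbT.
  case: (frozenP jm e) => [i'|i'|i'|i'|i'|e' p q].
  - by rewrite kind_along // => -[/pos_inj->]; rewrite !inE eqxx !orbT.
  - by rewrite kind_to_below.
  - by rewrite kind_to_above.
  - by rewrite kind_from_below.
  - by rewrite kind_from_above.
  - by rewrite kind_apart.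
rewrite !inE => /or3P[] /eqP->; last by rewrite kind_along.
- by rewrite /= /kind_mut below_row // (row_neq jm) eqxx addrK.
- by rewrite /= /kind_mut above_row // !(row_neq jm) eqxx.
Qed.

Lemma kind_prod_into h : (h < n)%N ->
  kind_prod j k (@var n m) [:: Into h] = into_at (k + h%:R).
Proof.
move=> hn; set i := k + h%:R; have ih : h = pos k i by rewrite pos_shift.
rewrite (@kind_prod_list _ _ [:: frz (mid i) (below i); frz (mid i) (above (i - 1))]);
  first by rewrite !big_cons big_nil mulr1.
  rewrite /= !inE frz_eq ?arrow_mid_below ?arrow_mid_above //.
  by rewrite below_neq_above // andbF.
move=> v; rewrite ih; apply/eqP/idP => [|].
  case: v => [a|e]; first by rewrite /= /kind_mut; do !case: ifP => _.
  case: (frozenP jm e) => [i'|i'|i'|i'|i'|e' p q].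
  - by rewrite kind_along.
  - by rewrite kind_to_below // => -[/pos_inj->]; rewrite !inE eqxx.
  - by rewrite kind_to_above // => -[/pos_inj->]; rewrite !inE eqxx orbT.
  - by rewrite kind_from_below.
  - by rewrite kind_from_above.
  - by rewrite kind_apart.
by rewrite !inE => /orP[] /eqP->; rewrite ?kind_to_below ?kind_to_above.
Qed.

Lemma kind_prod_from h : (h < n)%N ->
  kind_prod j k (@var n m) [:: From h] = from_at (k + h%:R).
Proof.
move=> hn; set i := k + h%:R; have ih : h = pos k i by rewrite pos_shift.
have downE i' : frz (below i') (mid (i' - 1)) = frz (below (i' - 1 + 1)) (mid (i' - 1)).
  by rewrite subrK.
rewrite (@kind_prod_list _ _ [:: frz (above i) (mid i); frz (below (i + 1)) (mid i)]);
  first by rewrite !big_cons big_nil mulr1.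
  rewrite /= !inE frz_eq ?arrow_down ?arrow_above_mid //.
  by rewrite above_neq_below.
move=> v; rewrite ih; apply/eqP/idP => [|].
  case: v => [a|e]; first by rewrite /= /kind_mut; do !case: ifP => _.
  case: (frozenP jm e) => [i'|i'|i'|i'|i'|e' p q].
  - by rewrite kind_along.
  - by rewrite kind_to_below.
  - by rewrite kind_to_above.
  - by rewrite kind_from_below // downE => -[/pos_inj->]; rewrite !inE eqxx orbT.
  - by rewrite kind_from_above // => -[/pos_inj->]; rewrite !inE eqxx.
  - by rewrite kind_apart.
have := kind_from_below k jm (i + 1); rewrite addrK => fb.
by rewrite !inE => /orP[] /eqP->; rewrite ?kind_from_above.
Qed.

(** [vertex_swap] acts on the kinds of vertices as [kind_swap]. *)
Lemma R_target_kind_prod p : (position p < n)%N -> (forall h, p != Row h) ->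
  kind_prod j k R_target [:: p] = kind_prod j k (@var n m) [:: kind_swap n p].
Proof.
move=> pn pr; rewrite /kind_prod [RHS](reindex_inj (inv_inj (vertex_swapK k jm))) /=.
apply: eq_big => [v|v].
  rewrite !inE kind_of_swap //; apply/eqP/eqP => [->//|e].
  by rewrite -(kind_swapK (@kind_of_position d m j k v)) e kind_swapK.
rewrite inE => /eqP vp; apply: R_target_outer.
case: v vp => // a /=; rewrite /kind_mut; case: ifP => // aj e.
by have := pr (pos k a.2); rewrite -e eqxx.
Qed.

Lemma kind_of_at_row v p : kind_of v = Row p -> v = inl (mid (k + p%:R)).
Proof.
move=> vp; apply/eqP; rewrite -(kind_of_row k jm) vp pos_shift ?eqxx //.
by have := @kind_of_position d m j k v; rewrite vp.
Qed.

Local Notation xk := (fun h => x_at (k + h%:R)).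
Local Notation ak := (fun h => along_at (k + h%:R)).
Local Notation bk := (fun h => into_at (k + h%:R)).
Local Notation ck := (fun h => from_at (k + h%:R)).

Local Notation row_data z G :=
  (G (fun h => z (inl (at_pos m j k h))) (fun h => kind_prod j k z [:: Along h])
     (fun h => kind_prod j k z [:: Into h]) (fun h => kind_prod j k z [:: From h])).

Lemma initial_row_var h : (h.+1 < n)%N ->
  row_data (@var n m) (row_var n) h = row_var n xk ak bk ck h.
Proof.
move=> hn; apply: row_var_ext => // i ilt.
- exact: kind_prod_along.
- exact: kind_prod_into.
- exact: kind_prod_from.
Qed.

Lemma initial_penultimate_var : row_data (@var n m) (penultimate_var n)
  = R_image m j (k + d.+2%:R).
Proof.
rewrite R_image_shift -penultimate_R; try by move=> i; apply: Zp_periodic.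
  rewrite /penultimate_var initial_row_var // kind_prod_along // kind_prod_from //.
  congr ((_ * _ + _) / _); apply: eq_big_nat => i /andP[_ ilt].
  by rewrite kind_prod_into //; lia.
by move=> i; apply: x_at_neq0.
Qed.

Lemma initial_last_var : row_data (@var n m) (last_var n) = R_image m j (k + d.+1%:R).
Proof.
rewrite R_image_shift -last_R; try by move=> i; apply: Zp_periodic.
  rewrite /last_var initial_row_var // kind_prod_along // kind_prod_into // kind_prod_from //.
  congr ((_ + _ * _ * _) / _); apply: eq_big_nat => i /andP[_ ilt].
  by rewrite kind_prod_from //; lia.
by move=> i; apply: x_at_neq0.
Qed.

(** By [row_var_invariant]: on the products of the three kinds the cluster
   R-matrix is the exchange of b and c with a shift. *)
Lemma R_target_row_var h : (forall i, R_image m j i != 0) -> (h < d.+1)%N ->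
  row_data R_target (row_var n) h = row_data (@var n m) (row_var n) h.
Proof.
move=> R_neq0 hd; rewrite initial_row_var; last by lia.
have per (f : 'Z_n -> F) p : f (k + (p + n)%:R) = f (k + p%:R) := Zp_periodic f k p.
rewrite -(@row_var_invariant F d xk ak bk ck (per _) (per _) (per _) (per _)
  (fun p => x_at_neq0 _) (fun p => R_image m j (k + p%:R))
  (fun p => from_at (k + p%:R - 1)) (fun p => into_at (k + p.+1%:R))
  (R_image_shift k) (fun p => R_neq0 _)) //; first last.
- congr from_at; rewrite addr0; congr (k + _); apply/eqP.
  by rewrite eq_sym -subr_eq0 opprK -Zp_natS (pchar_Zp (p := n)).
- by move=> p; rewrite Zp_natS addrA addrK.
have swap_at p : (forall q, p != Row q) -> (position p < n)%N -> forall q,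
    kind_swap n p = q -> kind_prod j k R_target [:: p] = kind_prod j k (@var n m) [:: q].
  by move=> pr pn q <-; apply: R_target_kind_prod.
have hn : (h.+1 < n)%N by lia.
apply: row_var_ext hn => p pn.
- by rewrite R_target_mid.
- by rewrite (@swap_at _ _ _ (Along p)) // kind_prod_along.
- rewrite (@swap_at _ _ _ (From (cyc_prev n p))) // kind_prod_from.
    by rewrite -{1}(pos_shift k pn) -pos_pred -addrA shift_pos addrA.
  by rewrite /cyc_prev; case: ifP => //; lia.
- rewrite (@swap_at _ _ _ (Into (cyc_next n p))) // kind_prod_into.
    by rewrite -{1}(pos_shift k pn) -pos_succ Zp_natS addrA shift_pos.
  by rewrite /cyc_next; case: ifP => //; lia.
Qed.

End Base.
End Target.

(** * Positivity of the images *)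

Section PositiveAt.

Variables (N : nat) (b : 'I_N -> rat).
Local Notation F := {fraction {mpoly rat[N]}}.

Definition positive_at (f : F) := exists2 c, 0 < c & evaluates b f c.

Lemma positive_atM f g : positive_at f -> positive_at g -> positive_at (f * g).
Proof.
by move=> [c c0 ec] [e e0 ee]; exists (c * e); [apply: mulr_gt0 | apply: evaluatesM].
Qed.

Lemma positive_atD f g : positive_at f -> positive_at g -> positive_at (f + g).
Proof.
by move=> [c c0 ec] [e e0 ee]; exists (c + e); [apply: addr_gt0 | apply: evaluatesD].
Qed.

Lemma positive_atV f : positive_at f -> positive_at f^-1.
Proof.
by move=> [c c0 ec]; exists c^-1; [rewrite invr_gt0 | apply: evaluatesV; rewrite ?gt_eqF].
Qed.

Lemma positive_at_prod (I : Type) (s : seq I) (f : I -> F) :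
  (forall i, positive_at (f i)) -> positive_at (\prod_(i <- s) f i).
Proof.
move=> pf; elim/big_rec: _ => [|i y _]; last exact: positive_atM.
by exists 1; last exact: evaluates1.
Qed.

Lemma positive_at_sum p q (f : nat -> F) : (p < q)%N ->
  (forall i, positive_at (f i)) -> positive_at (\sum_(p <= i < q) f i).
Proof.
move=> pq pf; rewrite -(subnKC pq); elim: (q - p.+1)%N => [|r IH].
  by rewrite addn0 big_nat1.
by rewrite addnS big_nat_recr ?leq_addr //=; [apply: positive_atD | lia].
Qed.

End PositiveAt.

(** * Performing the operations *)

Section Assembly.

Variables (d m j : nat).
Hypothesis jm : (0 < j < m)%N.

Local Notation n := d.+3.
Local Notation vertex := (vertex n m).
Local Notation F := (ratfield n m).
Local Notation mid := (@mid n m j).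
Local Notation below := (@below n m j).
Local Notation above := (@above n m j).
Implicit Types (i k : 'Z_n) (v : vertex).

Local Notation target := (@R_target d m j).

Lemma var_positive b v : (forall h, 0 < b h) -> positive_at b (var v).
Proof. by move=> b0; exists (b (enum_rank v)); last exact: var_evaluates. Qed.

Lemma R_image_positive b i : (forall h, 0 < b h) -> positive_at b (R_image m j i).
Proof.
move=> b0; have pv v : positive_at b (var v) by apply: var_positive.
have px h : positive_at b (x_at m j h) by apply: pv.
have pa h : positive_at b (along_at m j h) by do !apply: positive_atM; apply: pv.
have pi h : positive_at b (into_at m j h) by apply: positive_atM; apply: pv.
have pf h : positive_at b (from_at m j h) by apply: positive_atM; apply: pv.
rewrite R_image_ratio /R_ratio; apply: positive_atM; first exact: px.
apply: positive_at_sum => [|l]; first by rewrite -{1}[nat_of_ord i]addn0 ltn_add2l.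
apply: positive_atM; last by apply: positive_at_prod => h; apply: pi.
apply: positive_atM; last by apply: positive_at_prod => h; apply: pf.
by apply: positive_atM; last apply/positive_atV/positive_atM.
Qed.

Definition target_seed : seed n m := Seed (@enriched_quiver n m) target.

Lemma target_positive : positive_seed target_seed.
Proof.
split=> [|b b0]; first exact: initial_skew.
have [|c c0 ev] := @fin_all_exists2 vertex (fun=> rat) (fun v c => 0 < c)
  (fun v c => evaluates b (target v) c); last by exists c.
case=> [a|e] /=; last exact: var_positive.
by case: ifP => _; [apply: R_image_positive | apply: var_positive].
Qed.

Lemma R_image_neq0 i : R_image m j i != 0.
Proof.
have [//|c c0 ev] := @R_image_positive (fun=> 1) i.
by apply: evaluates_neq0 ev _; rewrite gt_eqF.
Qed.

Section Base.

Variable k : 'Z_n.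

Local Notation at_pos := (@at_pos d m j k).
Local Notation W s := (mutations (@row_seq d m j k d.+1) s).

(** The equality to which the theorem reduces by conjugation with the first
   n - 2 mutations. *)
Lemma middle_seed_eq :
  seed_eq (relabel (vertex_swap j k)
      (mutate (at_pos d.+2) (mutate (at_pos d.+1) (W (initial_seed n m)))))
    (W target_seed).
Proof.
have [form clus] := second_half k jm (@var n m).
have [//|//|formT clusT] := @first_half d m j k jm target d.+1.
split=> [u v fr|v].
  rewrite (exch_swap jm form fr); exact/esym/formT.
rewrite [RHS]clusT; apply: etrans (clus (vertex_swap j k v)) _.
rewrite kind_of_swap // /row_cluster.
case E: (kind_of j k v) => [p|p|p|p|] /=; last 1 first.
all: try by rewrite (R_target_outer jm k) //; case: v E => //= a; rewrite /kind_mut; case: ifP.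
have := @kind_of_position d m j k v; rewrite E /position /= => pn.
have -> := kind_of_at_row jm E.
rewrite R_target_mid // !eqSS; have [->|p1] := eqVneq p d.+1.
  rewrite ltnn ltnNge leqnSn gtn_eqF //.
  exact: initial_last_var.
have [->|p2] := eqVneq p d.+2.
  rewrite ltnn eqxx [(d.+2 < _)%N]ltnNge leqnSn.
  exact: initial_penultimate_var.
have pd : (p < d.+1)%N by lia.
by rewrite pd R_target_row_var // => i; apply: R_image_neq0.
Qed.

Lemma perform_mutations (T : Type) (f : T -> mut n m) l s :
  perform_all [seq Mutation (f h) | h <- l] s = mutations [seq f h | h <- l] s.
Proof. by rewrite /perform_all /mutations; elim: l s => //= a l IH s. Qed.

(** Since the transpositions are disjoint, at most one of them moves a given
   label, and the order does not matter. *)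
Lemma perform_transpositions (f : vertex -> vertex) (l : seq vertex) s :
  involutive f -> uniq l -> {in l, forall u, f u \notin l} ->
  (forall v, v \in l \/ f v \in l \/ f v = v) ->
  seed_eq (perform_all [seq Transposition u (f u) | u <- l] s) (relabel f s).
Proof.
move=> fK ul fl cov.
pose g (l : seq vertex) v := if (v \in l) || (f v \in l) then f v else v.
suff gP t : uniq t -> {in t, forall u, f u \notin t} -> forall s,
    (forall u v, exch (perform_all [seq Transposition u (f u) | u <- t] s) u v
       = exch s (g t u) (g t v))
    /\ (forall v, cluster (perform_all [seq Transposition u (f u) | u <- t] s) v
       = cluster s (g t v)).
  have gE : g l =1 f.
    move=> v; rewrite /g; case: (cov v) => [->//|[->|->]]; first by rewrite orbT.
    by case: ifP.
  by have [e c] := gP l ul fl s; split=> [u v _|v]; rewrite ?e ?c /= !gE.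
elim: t => [|u t IH] //= /andP[ut tt] ft {}s.
have fut : f u \notin t.
  by have := ft u (mem_head _ _); rewrite inE => /norP[].
have ftt : {in t, forall u', f u' \notin t}.
  by move=> w wt; have := ft w; rewrite !inE wt orbT => /(_ isT) /norP[].
have sE v : swap u (f u) (g t v) = g (u :: t) v.
  rewrite /g !inE; have [->|vu] := eqVneq v u.
    by rewrite (negPf ut) (negPf fut) /= /swap eqxx.
  have [fvu|fvu] := eqVneq (f v) u.
    have vE : v = f u by rewrite -fvu fK.
    by rewrite vE fK (negPf ut) (negPf fut) /= ?orbT /swap -vE (negPf vu) eqxx.
  rewrite /=; case: ifP => _.
    by rewrite /swap (negPf fvu) (inj_eq (inv_inj fK)) (negPf vu).
  by rewrite /swap (negPf vu) -(inj_eq (inv_inj fK)) fK (negPf fvu).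
have [e c] := IH tt ftt (transpose u (f u) s).
by split=> [v w|v]; rewrite ?e ?c /= !sE.
Qed.

(** One vertex from each of the transpositions. *)
Definition swap_sources : seq vertex := inl (mid (k - 2%:R))
  :: [seq frz (mid i) (above (i - 1)) | i <- enum 'Z_n]
  ++ [seq frz (above i) (mid i) | i <- enum 'Z_n].

Lemma R_operationsE : R_operations m j k =
  [seq Mutation (at_pos h) | h <- iota 0 n]
  ++ [seq Mutation (at_pos h) | h <- rev (iota 0 d.+1)]
  ++ [seq Transposition u (vertex_swap j k u) | u <- swap_sources].
Proof.
rewrite /R_operations; congr (_ ++ (_ ++ _)).
rewrite /swap_sources /= eqxx map_cat; congr (_ :: _ ++ _).
  rewrite /image_mem -[RHS]map_comp.
  by apply: eq_map => i /=; rewrite vertex_swap_to_above.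
rewrite /image_mem -[RHS]map_comp.
by apply: eq_map => i /=; rewrite vertex_swap_from_above.
Qed.

Lemma mem_up i : frz (mid i) (above (i - 1)) \in swap_sources.
Proof.
rewrite inE mem_cat; apply/orP; right; apply/orP; left.
by apply/mapP; exists i; rewrite ?mem_enum.
Qed.

Lemma mem_from_above i : frz (above i) (mid i) \in swap_sources.
Proof.
rewrite inE mem_cat; apply/orP; right; apply/orP; right.
by apply/mapP; exists i; rewrite ?mem_enum.
Qed.

Lemma swap_sourcesP v : v \in swap_sources ->
  [\/ v = inl (mid (k - 2%:R)), exists i, v = frz (mid i) (above (i - 1))
    | exists i, v = frz (above i) (mid i)].
Proof.
rewrite inE mem_cat => /or3P[/eqP->|/mapP[i _ ->]|/mapP[i _ ->]].
- by constructor 1.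
- by constructor 2; exists i.
- by constructor 3; exists i.
Qed.

Lemma frz_frozen (b b' : mut n m) : arrow b b' -> is_frozen (frz b b').
Proof. by move=> h; rewrite (frzE h). Qed.

Lemma swap_sources_uniq : uniq swap_sources.
Proof.
rewrite /= cat_uniq; apply/and4P; split.
- rewrite mem_cat negb_or; apply/andP; split; apply/mapP => -[i _ e].
    by have := frz_frozen (arrow_mid_above i jm); rewrite -e.
  by have := frz_frozen (arrow_above_mid i jm); rewrite -e.
- rewrite map_inj_uniq ?enum_uniq // => i i' /eqP.
  by rewrite frz_eq ?arrow_mid_above // => /andP[/eqP/mid_inj].
- apply/hasPn => _ /mapP[i _ ->]; apply/mapP => -[i' _ /(congr1 (kind_of j k))].
  by rewrite kind_to_above // kind_from_above.
- rewrite map_inj_uniq ?enum_uniq // => i i' /eqP.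
  by rewrite frz_eq ?arrow_above_mid // => /andP[_ /eqP/mid_inj].
Qed.

Lemma vertex_swap_last2 : vertex_swap j k (inl (mid (k - 2%:R))) = inl (mid (k - 1)).
Proof. by rewrite /= eqxx. Qed.

Lemma mid_last2_neq : mid (k - 1) != mid (k - 2%:R).
Proof.
rewrite (inj_eq (@mid_inj d m j)) -(inj_eq (@pos_inj d k)) pos_last pos_last2.
by rewrite gtn_eqF.
Qed.

Lemma swap_sources_disjoint :
  {in swap_sources, forall u, vertex_swap j k u \notin swap_sources}.
Proof.
move=> _ /swap_sourcesP[->|[i ->]|[i ->]].
- rewrite vertex_swap_last2; apply/negP => /swap_sourcesP[[/eqP]|[i e]|[i e]].
  + rewrite -[_ == _]/(k - 1 == k - 2%:R) => e.
    by have := mid_last2_neq; rewrite (eqP e) eqxx.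
  + by have := frz_frozen (arrow_mid_above i jm); rewrite -e.
  + by have := frz_frozen (arrow_above_mid i jm); rewrite -e.
- rewrite vertex_swap_to_above //; apply/negP => /swap_sourcesP[e|[i' e]|[i' /eqP]].
  + by have := frz_frozen (arrow_below_mid i jm); rewrite e.
  + by have := congr1 (kind_of j k) e; rewrite kind_to_above // kind_from_below.
  + by rewrite frz_eq ?arrow_below_mid ?arrow_above_mid // below_neq_above.
- rewrite vertex_swap_from_above //; apply/negP => /swap_sourcesP[e|[i' /eqP]|[i' e]].
  + by have := frz_frozen (arrow_mid_below (i + 1) jm); rewrite e.
  + by rewrite frz_eq ?arrow_mid_below ?arrow_mid_above // below_neq_above // andbF.
  + by have := congr1 (kind_of j k) e; rewrite kind_to_below // kind_from_above.
Qed.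

Lemma swap_sources_cover v : v \in swap_sources \/
  vertex_swap j k v \in swap_sources \/ vertex_swap j k v = v.
Proof.
case: v => [a|e].
  have [->|a2] := eqVneq a (mid (k - 2%:R)); first by left; rewrite mem_head.
  have [->|a1] := eqVneq a (mid (k - 1)).
    by right; left; rewrite -vertex_swap_last2 vertex_swapK // mem_head.
  by right; right; rewrite /= (negPf a2) (negPf a1).
case: (frozenP jm e) => [i|i|i|i|i|e' p q].
- by right; right; rewrite vertex_swap_along.
- by right; left; rewrite vertex_swap_to_below // mem_from_above.
- by left; apply: mem_up.
- by right; left; rewrite vertex_swap_from_below // mem_up.
- by left; apply: mem_from_above.
- by right; right; rewrite vertex_swap_apart.
Qed.

(** The remaining mutations take both sides of [middle_seed_eq] back through the
   first n - 2 mutations. *)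
Lemma undo_seed_eq : seed_eq
  (mutations (rev (row_seq m j k d.+1)) (relabel (vertex_swap j k)
      (mutate (at_pos d.+2) (mutate (at_pos d.+1) (W (initial_seed n m))))))
  target_seed.
Proof.
apply: seed_eq_trans (mutationsK (row_seq m j k d.+1) target_positive).
apply: mutations_eq middle_seed_eq.
by apply: relabel_skew; do 2!apply: mutate_skew; apply: mutations_skew; apply: initial_skew.
Qed.

(** The transpositions, performed last, move to the front of the mutations that
   undo the first n - 2, whose vertices they fix. *)
Lemma perform_R_operations :
  seed_eq (perform_all (R_operations m j k) (initial_seed n m)) target_seed.
Proof.
rewrite R_operationsE /perform_all !foldl_cat -!/(perform_all _ _).
apply: seed_eq_trans undo_seed_eq.
apply: (seed_eq_trans (perform_transpositions _ (vertex_swapK k jm) swap_sources_uniq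
  swap_sources_disjoint swap_sources_cover)).
rewrite !perform_mutations -/(row_seq m j k n) map_rev -/(row_seq m j k d.+1).
rewrite !row_seqS -row_seqS !mutations_rcons.
apply: relabel_mutations; last 1 first.
- move=> a; rewrite mem_rev => /mapP[h]; rewrite mem_iota /= => hd ->.
  have hn : (h < n)%N by lia.
  have pn : pos k (k + h%:R) = h by rewrite pos_shift.
  rewrite /vertex_swap /at_pos !(inj_eq (@mid_inj d m j)) -!(inj_eq (@pos_inj d k)).
  by rewrite pn pos_last pos_last2 !ltn_eqF //; lia.
- by do 2!apply: mutate_skew; apply: mutations_skew; apply: initial_skew.
- exact: vertex_swapK.
Qed.

End Base.
End Assembly.

(** * The cluster R-matrix *)

Section Conclusion.

Variables (d m j : nat).
Hypothesis jm : (0 < j < m)%N.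

Local Notation n := d.+3.
Local Notation mid := (@mid n m j).
Local Notation below := (@below n m j).
Local Notation above := (@above n m j).
Local Notation target := (@R_target d m j).
Implicit Types (i k : 'Z_n) (v : vertex n m).

Lemma R_target_frzE (b b' : mut n m) v : arrow b b' ->
  vertex_swap j 0 (frz b b') = v -> target (frz b b') = var v.
Proof. by move=> h <-; apply: R_target_frz. Qed.

Lemma R_movedP v : R_moved j v = ~~ (
  (if kind_of j 0 v is Along _ then true else false) || (kind_of j 0 v == Apart)).
Proof.
apply/existsP/idP => [[i]|].
  rewrite !inE => /or4P[/eqP->|/eqP->|/eqP->|/orP[]/eqP->].
  - by rewrite kind_mid.
  - by rewrite kind_from_above.
  - by rewrite kind_to_below.
  - by rewrite kind_to_above.
  - by rewrite kind_from_below.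
case: v => [a|e].
  rewrite /= /kind_mut; case: ifP => [aj _|_]; last by do !case: ifP => _.
  exists a.2; rewrite inE; apply/orP; left.
  by rewrite -[_ == _]/(a == _) mid_eq // aj eqxx.
case: (frozenP jm e) => [i|i|i|i|i|e' p q].
- by rewrite kind_along.
- by move=> _; exists (i - 1); rewrite !inE subrK eqxx !orbT.
- by move=> _; exists i; rewrite !inE eqxx !orbT.
- by move=> _; exists i; rewrite !inE eqxx !orbT.
- by move=> _; exists i; rewrite !inE eqxx !orbT.
- by rewrite kind_apart.
Qed.

Lemma R_target_fixed v : ~~ R_moved j v -> target v = var v.
Proof.
rewrite R_movedP negbK; case: v => [a|e].
  by rewrite /= /kind_mut; case: ifP.
case: (frozenP jm e) => [i|i|i|i|i|e' p q] //.
- by move=> _; apply: R_target_frzE; rewrite ?arrow_mid_mid ?vertex_swap_along.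
- by rewrite kind_to_below.
- by rewrite kind_to_above.
- by rewrite kind_from_below.
- by rewrite kind_from_above.
- by move=> _; rewrite /R_target vertex_swap_apart.
Qed.

Lemma cluster_R_matrixP (R : {rmorphism ratfield n m -> ratfield n m}) :
  is_cluster_R_matrix j R <-> (forall v, R (var v) = target v).
Proof.
split=> [[Rx Rs Rs' Rf] v|RE].
  have [|/[dup] /Rf -> /R_target_fixed -> //] := boolP (R_moved j v).
  case/existsP => i; rewrite !inE => /or4P[/eqP->|/eqP->|/eqP->|/orP[]/eqP->].
  - by rewrite Rx R_target_mid.
  - rewrite (proj1 (Rs i)); apply/esym/R_target_frzE; first exact: arrow_above_mid.
    exact: vertex_swap_from_above.
  - rewrite (proj2 (Rs i)); apply/esym/R_target_frzE; first exact: arrow_mid_below.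
    by rewrite vertex_swap_to_below // addrK.
  - rewrite (proj1 (Rs' i)); apply/esym/R_target_frzE; first exact: arrow_mid_above.
    exact: vertex_swap_to_above.
  - rewrite (proj2 (Rs' i)); apply/esym/R_target_frzE; first exact: arrow_below_mid.
    exact: vertex_swap_from_below.
split=> [i|i|i|v vf]; rewrite ?RE.
- exact: R_target_mid.
- split; apply: R_target_frzE; rewrite ?arrow_above_mid ?arrow_mid_below //.
    exact: vertex_swap_from_above.
  by rewrite vertex_swap_to_below // addrK.
- split; apply: R_target_frzE; rewrite ?arrow_mid_above ?arrow_below_mid //.
    exact: vertex_swap_to_above.
  exact: vertex_swap_from_below.
- exact: R_target_fixed.
Qed.

Lemma cluster_R_matrix_exists :
  exists R : {rmorphism ratfield n m -> ratfield n m}, is_cluster_R_matrix j R.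
Proof.
have [_ clus] := undo_seed_eq jm (0 : 'Z_n).
have [|R RE] := @dominant_seed_endomorphism n m (mutations (rev (row_seq m j 0 d.+1))
    (relabel (vertex_swap j 0) (mutate (at_pos m j 0 d.+2) (mutate (at_pos m j 0 d.+1)
      (mutations (row_seq m j 0 d.+1) (initial_seed n m)))))).
  apply/mutations_dominant/relabel_dominant; first exact: vertex_swapK.
  exact/mutate_dominant/mutate_dominant/mutations_dominant/initial_dominant.
by exists R; apply/cluster_R_matrixP => v; rewrite RE clus.
Qed.

Lemma R_operations_count k :
  [/\ size (R_operations m j k) = (2 * n - 2 + (2 * n + 1))%N,
      count (@is_mutation n m) (R_operations m j k) = (2 * n - 2)%N
    & count (@is_transposition n m) (R_operations m j k) = (2 * n + 1)%N].
Proof.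
have szn : size (enum 'Z_n) = n by rewrite -cardE card_ord.
have szs : size (swap_sources m j k) = (2 * n + 1)%N.
  by rewrite /swap_sources -cat1s !size_cat 2!size_map szn [size [:: _]]/=; lia.
have swap_neq u : u \in swap_sources m j k -> u != vertex_swap j k u.
  move=> us; apply/eqP => e; have := swap_sources_disjoint jm us.
  by rewrite -e us.
have muts (T : eqType) (f : T -> mut n m) l :
    (count (@is_mutation n m) [seq Mutation (f h) | h <- l] = size l)
    * (count (@is_transposition n m) [seq Mutation (f h) | h <- l] = 0%N).
  by split; rewrite count_map ?count_predT // count_pred0.
rewrite (R_operationsE jm) !count_cat !size_cat !size_map !muts size_rev !size_iota szs.
have -> : count (@is_mutation n m)
    [seq Transposition u (vertex_swap j k u) | u <- swap_sources m j k] = 0%N.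
  by rewrite count_map count_pred0.
have -> : count (@is_transposition n m)
    [seq Transposition u (vertex_swap j k u) | u <- swap_sources m j k] = (2 * n + 1)%N.
  rewrite count_map -szs; apply/eqP; rewrite -all_count; apply/allP => u /swap_neq.
  by [].
by split; lia.
Qed.

End Conclusion.

Theorem theorem3p3 (n m : nat) (hn : (3 <= n)%N) (hm : (2 <= m)%N)
    (j : nat) (hj : (1 <= j <= m.-1)%N) :
  (exists R : {rmorphism ratfield n m -> ratfield n m},
     is_cluster_R_matrix j R)
  /\
  (forall (R : {rmorphism ratfield n m -> ratfield n m}) (k : 'Z_n),
     is_cluster_R_matrix j R ->
     [/\ size (R_operations m j k) = (2 * n - 2 + (2 * n + 1))%N,
         count (@is_mutation n m) (R_operations m j k) = (2 * n - 2)%N,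
         count (@is_transposition n m) (R_operations m j k) = (2 * n + 1)%N
       & seed_eq (perform_all (R_operations m j k) (initial_seed n m))
                 (Seed (@enriched_quiver n m) (fun v => R (var v)))]).
Proof.
have jm : (0 < j < m)%N by lia.
case: n hn => [|[|[|d]]] // _; split; first exact: cluster_R_matrix_exists.
move=> R k /(cluster_R_matrixP jm) RE.
have [sz cm ct] := R_operations_count jm k; split=> //.
have [e c] := perform_R_operations jm k.
by split=> [|v] //; rewrite c /= RE.
Qed.
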